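(* Let $Q=(V,A)$, $V=\{1,\dots,n\}$, be a connected acyclic digraph (without multiple arrows) such that every vertex has degree at most $2$ in the underlying graph $\overline Q$. Then exactly one of the following holds. (a) $Q$ is not $2$-regular, $\overline Q$ is the path graph $\mathbb A_n$, and $Q$ is the Hasse digraph of $I_Q$, which is positive with $\mathrm{Dyn}_{I_Q}=\mathbb A_n$. (b) $Q$ is $2$-regular and $\overline Q$ is a cycle. Moreover: (b1) if $Q$ has exactly one sink, then (i) if $Q\simeq\overline{\mathbb A}_{n-1,1}$, then $\mathrm{Dyn}_{I_Q}=\mathbb A_n$, $I_Q$ is positive and $\mathcal H(I_Q)\ne Q$; (ii) if $Q\simeq\overline{\mathbb A}_{n-2,2}$, then $\mathrm{Dyn}_{I_Q}=\mathbb D_n$, $I_Q$ is positive and $\mathcal H(I_Q)=Q$; (iii) if $Q\simeq \overline{\mathbb A}_{3,3},\overline{\mathbb A}_{4,3},\overline{\mathbb A}_{5,3}$, then $\mathcal H(I_Q)=Q$, $I_Q$ is positive and $\mathrm{Dyn}_{I_Q}=\mathbb E_6,\mathbb E_7,\mathbb E_8$ respectively; if $Q\simeq\overline{\mathbb A}_{4,4},\overline{\mathbb A}_{6,3}$, then $\mathcal H(I_Q)=Q$, $I_Q$ is principal and $\mathrm{Dyn}_{I_Q}=\mathbb E_7,\mathbb E_8$ respectively; (iv) otherwise $I_Q$ is indefinite; (b2) if $Q$ has more than one sink, then $I_Q$ is principal, $\mathrm{Dyn}_{I_Q}=\mathbb A_{n-1}$ and $\mathcal H(I_Q)=Q$.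
   Context: For an acyclic digraph $Q$ on $\{1,\dots,n\}$, $I_Q$ is the poset with $a\preceq b$ iff there is a directed path from $a$ to $b$ in $Q$ (including $a=b$). For $1\le r\le p$ and $n=p+r\ge3$, $\overline{\mathbb A}_{p,r}$ is the digraph on $\{1,\dots,n\}$ with arrows $1\to2\to\cdots\to p\to n$ and $1\to p+1\to p+2\to\cdots\to p+r-1\to n$ (two directed chains from $1$ to $n$ with $p$ and $r$ arrows; for $r=1$ the second is the single arrow $1\to n$). A digraph is $2$-regular if every vertex has degree $2$ in the underlying graph; a sink is a vertex that is the tail of no arrow. For a poset $I$: $C_I=[c_{ij}]$, $c_{ij}=1$ iff $i\preceq_I j$; $G_I=\tfrac12(C_I+C_I^{tr})$; $q_I(v)=vG_Iv^{tr}$; $I$ is non-negative of corank $r$ if $G_I$ is positive semi-definite of rank $n-r$, positive if corank $0$, principal if corank $1$, indefinite if $G_I$ is neither positive nor negative semi-definite. $\mathcal H(I)$: arrow $i\to j$ iff $i\prec_I j$ with nothing strictly between. Dynkin graphs: $\mathbb A_m$ path on $m$ vertices; $\mathbb D_m$ path on $m-1$ vertices plus a vertex attached to the second; $\mathbb E_6,\mathbb E_7,\mathbb E_8$ trees with one branch vertex and arms of $1,2,2$ / $1,2,3$ / $1,2,4$ vertices; for a graph $\Gamma$ on $m$ vertices $G_\Gamma=E_m-\tfrac12\mathrm{Adj}(\Gamma)$. Dynkin type of a connected non-negative $I$ of corank $r$: $\mathrm{Ker}\,q_I=\{v\in\mathbb Z^n:q_I(v)=0\}$ has a $\mathbb Z$-basis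 $h^{(1)},\dots,h^{(r)}$ with $h^{(i)}_{k_j}=\delta_{ij}$ for some $k_1<\dots<k_r$; $I'=I\setminus\{k_1,\dots,k_r\}$ is connected positive with $G_{I'}=B^{tr}G_DB$, $B\in GL(n-r,\mathbb Z)$, for a unique Dynkin graph $D$; $\mathrm{Dyn}_I:=D$. *)

(* Defs.v *)
From HB Require Import structures.
From mathcomp Require Import all_boot all_order all_algebra perm.
Set Implicit Arguments. Unset Strict Implicit. Unset Printing Implicit Defensive.
Import Order.TTheory GRing.Theory Num.Theory.

(* Vertices {1,...,n} are represented by 'I_n (vertex k+1 <-> ordinal k).
   A digraph without multiple arrows is a boolean relation Q : rel 'I_n
   (Q i j  <->  arrow i -> j). *)

Section Digraph.
Variable n : nat.
Implicit Type Q : rel 'I_n.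

Definition ugraph Q : rel 'I_n := fun i j => Q i j || Q j i.
Definition degree Q (i : 'I_n) : nat := #|[set j | ugraph Q i j]|.
Definition connected_dg Q : Prop := forall i j, connect (ugraph Q) i j.
Definition acyclic_dg Q : Prop := forall i j, Q i j -> ~~ connect Q j i.
Definition two_regular Q : Prop := forall i, degree Q i = 2.
Definition sinks Q : {set 'I_n} := [set i | [forall j, ~~ Q i j]].

Definition is_path_graph Q : Prop :=
  exists s : {perm 'I_n}, forall i j,
    ugraph Q i j = (((s i).+1 == s j) || ((s j).+1 == s i)).
Definition is_cycle_graph Q : Prop :=
  3 <= n /\ exists s : {perm 'I_n}, forall i j,
    ugraph Q i j = (((s i).+1 %% n == s j) || ((s j).+1 %% n == s i)).

Definition poset_le Q : rel 'I_n := connect Q.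

Definition hasse Q : rel 'I_n := fun i j =>
  [&& i != j, poset_le Q i j &
      [forall k, ~~ [&& k != i, k != j, poset_le Q i k & poset_le Q k j]]].

Definition incidence Q : 'M[rat]_n := \matrix_(i, j) ((poset_le Q i j)%:R)%R.
Definition gram Q : 'M[rat]_n :=
  ((1 / 2 : rat) *: (incidence Q + (incidence Q)^T))%R.

Definition qform (G : 'M[rat]_n) (v : 'rV[rat]_n) : rat := (v *m G *m v^T)%R ord0 ord0.
Definition psd (G : 'M[rat]_n) : Prop := forall v, (0 <= qform G v)%R.
Definition nsd (G : 'M[rat]_n) : Prop := forall v, (qform G v <= 0)%R.

Definition nonneg_corank Q (r : nat) : Prop :=
  psd (gram Q) /\ \rank (gram Q) = (n - r)%N.
Definition positive_poset Q : Prop := nonneg_corank Q 0.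
Definition principal_poset Q : Prop := nonneg_corank Q 1.
Definition indefinite_poset Q : Prop := ~ psd (gram Q) /\ ~ nsd (gram Q).

Definition qint Q (v : 'rV[int]_n) : rat := qform (gram Q) (map_mx (fun z : int => (z%:~R : rat)%R) v).

End Digraph.

Inductive dynkin := DynA of nat | DynD of nat | DynE6 | DynE7 | DynE8.

Definition dyn_size (D : dynkin) : nat :=
  match D with DynA m => m | DynD m => m | DynE6 => 6 | DynE7 => 7 | DynE8 => 8 end.

(* edges on vertices 0..m-1 :
   A_m : path 0-1-...-(m-1);
   D_m : path 0-1-...-(m-2) plus vertex m-1 attached to vertex 1;
   E_m : branch vertex 0, arms (1), (2-3), (4-5-...-(m-1)). *)
Definition dyn_edge0 (D : dynkin) (i j : nat) : bool :=
  match D with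
  | DynA _ => i.+1 == j
  | DynD m => ((i.+1 == j) && (j <= m - 2)) || ((i == 1) && (j == m - 1))
  | _ => [|| (i == 0) && (j == 1), (i == 0) && (j == 2), (i == 2) && (j == 3),
             (i == 0) && (j == 4) | (4 <= i) && (j == i.+1)]
  end.
Definition dyn_edge (D : dynkin) (i j : nat) : bool :=
  dyn_edge0 D i j || dyn_edge0 D j i.

Definition dyn_gram (D : dynkin) (m : nat) : 'M[rat]_m :=
  \matrix_(i, j) (((i == j)%:R - (dyn_edge D i j)%:R / 2)%R : rat).

Definition Dyn_is (n : nat) (Q : rel 'I_n) (D : dynkin) : Prop :=
  exists r : nat, nonneg_corank Q r /\
  exists (k : 'I_r -> 'I_n) (h : 'I_r -> 'rV[int]_n),
    [/\ (forall a b : 'I_r, a < b -> k a < k b),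
        (forall a, qint Q (h a) = 0%R) /\
        (forall a b, h a ord0 (k b) = ((a == b)%:R)%R),
        (forall v, qint Q v = 0%R ->
           exists c : 'I_r -> int, v = (\sum_(a < r) c a *: h a)%R),
        dyn_size D = (n - r)%N &
        exists f : 'I_(n - r) -> 'I_n,
          [/\ injective f,
              (forall x, (x \in codom f) = (x \notin codom k)) &
              exists B : 'M[int]_(n - r), B \in unitmx /\
                ((\matrix_(i, j) gram Q (f i) (f j))%R : 'M[rat]_(n - r))
                  = ((map_mx (fun z : int => (z%:~R : rat)%R) B)^T *m dyn_gram D (n - r)
                      *m map_mx (fun z : int => (z%:~R : rat)%R) B)%R]].

(* the digraph \bar A_{p,r} on 'I_(p+r): chains 1->2->...->p->n and
   1->p+1->...->p+r-1->n (0-indexed below) *)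
Definition abar_arrows (p r : nat) : seq (nat * nat) :=
  let c1 := rcons (iota 0 p) (p + r - 1) in
  let c2 := 0 :: rcons (iota p (r - 1)) (p + r - 1) in
  zip c1 (behead c1) ++ zip c2 (behead c2).
Definition abar (n p r : nat) : rel 'I_n :=
  fun i j => ((i : nat), (j : nat)) \in abar_arrows p r.

Definition iso_abar (n : nat) (Q : rel 'I_n) (p r : nat) : Prop :=
  [/\ 1 <= r, r <= p, p + r = n &
      exists s : {perm 'I_n}, forall i j, Q i j = abar p r (s i) (s j)].

(* Main.v *)
Require Import Defs.
From mathcomp Require Import all_boot all_order all_algebra perm.
From mathcomp Require Import zify ring.
Set Implicit Arguments. Unset Strict Implicit. Unset Printing Implicit Defensive.
Import Order.TTheory GRing.Theory Num.Theory.

(* Once a digraph of degree at most 2 is cut into its maximal monotone runs, a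
   comparability is a run containing both vertices.  For a path, sending a vertex
   to a root +-(e_a - e_b), where a is the coordinate of the run entering it, is a
   unimodular change of basis from the form of the poset to that of A_n.
   A cycle is cut at a sink.  With at least two sinks, the vector with entries 1 at
   sinks, -1 at sources and 0 elsewhere is in the kernel, and deleting the sink
   leaves a path with n-1 vertices.  With one sink, the cycle is some abar p r: for
   r <= 2 one writes explicit roots of A_n or D_n, the cases E6, E7, E8 and their
   one-point extensions (4,4), (6,3) are checked by computation, and when
   2(p+r) < pr the vector (-pr; 2r on the first chain; 2p on the second; -pr) has
   negative norm. *)

(** * Quadratic forms and Dynkin types *)

Local Open Scope ring_scope.

Local Notation intQ := (fun z : int => z%:~R : rat).

(** Twice the Gram matrix has 2 on the diagonal and 1 at comparable pairs. Type [D] therefore means: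
    the vertices can be sent to roots of [D] forming a Z-basis of the root lattice, with inner
    product 1 for comparable vertices and 0 otherwise. For a path the difficulty is a turning
    vertex, which lies in two runs; its root has one coordinate for each, and a sign makes both
    products equal to 1. Cutting a cycle at a sink turns it into a path on positions 0,...,n whose
    two ends are copies of the sink. The comparabilities of the sink are the sum of those of its
    copies, provided no vertex reaches it from both sides. With at least two sinks this holds, and
    the cycle inherits the behaviour of a path. With one sink the source reaches it from both sides
    and is counted once instead of twice; this single entry is what lets D and E appear. The bound
    2(p+r) < pr reads (p-2)(r-2) > 4. For r at least 3, equality gives (4,4) and (6,3), where the
    same vector becomes a null vector, and the reverse inequality gives the three positive cases. *)

Definition pos_def m (G : 'M[rat]_m) : Prop :=
  forall v, 0 <= qform G v /\ (qform G v = 0 -> v = 0).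

Lemma qformE m (G : 'M[rat]_m) v :
  qform G v = \sum_i \sum_j v 0 i * G i j * v 0 j.
Proof.
rewrite /qform mxE exchange_big; apply: eq_bigr => j _.
by rewrite !mxE big_distrl.
Qed.

Lemma qform_congr m (G B : 'M[rat]_m) v :
  qform (B *m G *m B^T) v = qform G (v *m B).
Proof. by rewrite /qform trmx_mul !mulmxA. Qed.

Lemma pos_def_congr m (G B : 'M[rat]_m) :
  B \in unitmx -> pos_def G -> pos_def (B *m G *m B^T).
Proof.
move=> uB pG v; rewrite qform_congr; have [ge0 eq0] := pG (v *m B).
split=> // /eq0 vB0.
by rewrite -[v](mulmxK uB) vB0 mul0mx.
Qed.

Lemma pos_defZ m (G : 'M[rat]_m) (c : rat) :
  0 < c -> pos_def G -> pos_def (c *: G).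
Proof.
move=> c0 pG v; have [ge0 eq0] := pG v.
have -> : qform (c *: G) v = c * qform G v.
  by rewrite /qform -scalemxAr -scalemxAl mxE.
split; first by rewrite mulr_ge0 // ltW.
by move/eqP; rewrite mulf_eq0 gt_eqF //= => /eqP.
Qed.

Lemma sum_inj_support (R : nmodType) (T U : finType) (f : T -> U) (F : U -> R) :
  injective f -> (forall u, u \notin codom f -> F u = 0) ->
  \sum_u F u = \sum_t F (f t).
Proof.
move=> f_inj F0.
rewrite (bigID [in codom f]) /= addrC big1 ?add0r => [|u /F0 //].
rewrite (eq_bigl [in f @: T]) => [|u]; last first.
  by apply/codomP/imsetP => [[x ->]|[x _ ->]]; exists x.
by rewrite big_imset //= => x y _ _; apply: f_inj.
Qed.

Lemma qform_support m n (G : 'M[rat]_n) (f : 'I_m -> 'I_n) (v : 'rV[rat]_n) :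
  injective f -> (forall i, i \notin codom f -> v 0 i = 0) ->
  qform G v = qform (\matrix_(i, j) G (f i) (f j)) (\row_i v 0 (f i)).
Proof.
move=> f_inj v0; rewrite !qformE (sum_inj_support f_inj); last first.
  by move=> i /v0 vi; rewrite big1 // => j _; rewrite vi !mul0r.
apply: eq_bigr => i _; rewrite (sum_inj_support f_inj).
  by apply: eq_bigr => j _; rewrite !mxE.
by move=> j /v0 vj; rewrite vj mulr0.
Qed.

Lemma pos_def_support m n (G : 'M[rat]_n) (f : 'I_m -> 'I_n) (v : 'rV[rat]_n) :
  injective f -> pos_def (\matrix_(i, j) G (f i) (f j)) ->
  (forall i, i \notin codom f -> v 0 i = 0) ->
  0 <= qform G v /\ (qform G v = 0 -> v = 0).
Proof.
move=> f_inj pG v0; rewrite (qform_support _ f_inj v0).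
have [ge0 eq0] := pG (\row_i v 0 (f i)); split=> // /eq0 /rowP v0'.
apply/rowP => i; rewrite mxE; have [/codomP[x ->]|/v0//] := boolP (i \in codom f).
by have := v0' x; rewrite !mxE.
Qed.

Lemma pos_def_rank m (G : 'M[rat]_m) : pos_def G -> \rank G = m.
Proof.
move=> pG; apply/eqP; rewrite -/(row_free G) -kermx_eq0.
apply/rowV0P => v /sub_kermxP vG; have [_ ->//] := pG v.
by rewrite /qform vG mul0mx mxE.
Qed.

(* A null vector [h] with [h_k = 1] reduces [v] to the hyperplane [v_k = 0]. *)
Section Corank1.
Variables (m n : nat) (G : 'M[rat]_n) (f : 'I_m -> 'I_n) (k : 'I_n).
Variable h : 'rV[rat]_n.
Hypotheses (f_inj : injective f) (fk : forall i, (i \in codom f) = (i != k)).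
Hypotheses (Gsym : G^T = G) (hG : h *m G = 0) (hk : h 0 k = 1).
Hypothesis pG : pos_def (\matrix_(i, j) G (f i) (f j)).

Lemma qform_mod_null v : qform G v = qform G (v - v 0 k *: h).
Proof.
have Gh : G *m h^T = 0 by rewrite -Gsym -trmx_mul hG trmx0.
rewrite /qform mulmxBl -scalemxAl hG scaler0 subr0.
rewrite linearB linearZ /= mulmxBr -scalemxAr -[v *m G *m h^T]mulmxA Gh.
by rewrite mulmx0 scaler0 subr0.
Qed.

Lemma corank1_form v : 0 <= qform G v /\ (qform G v = 0 -> v = v 0 k *: h).
Proof.
rewrite qform_mod_null.
have [|ge0 eq0] := @pos_def_support m n G f (v - v 0 k *: h) f_inj pG.
  by move=> i; rewrite fk negbK => /eqP ->; rewrite !mxE hk mulr1 subrr.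
by split=> // /eq0 /eqP; rewrite subr_eq0 => /eqP.
Qed.

(** A vector of the kernel is isotropic, hence a multiple of [h], so the kernel is a line. *)
Lemma corank1_rank : \rank G = (n - 1)%N.
Proof.
have h0 : h != 0 by apply/eqP => /rowP /(_ k); rewrite hk mxE => /eqP; rewrite oner_eq0.
have rk : \rank (kermx G) = 1%N.
  have <- : \rank h = 1%N by rewrite rank_rV h0.
  apply/eqP; rewrite eqn_leq !mxrankS //; first exact/sub_kermxP.
  apply/rV_subP => v /sub_kermxP vG; have [_ ->] := corank1_form v.
    exact: scalemx_sub.
  by rewrite /qform vG mul0mx mxE.
by have := mxrank_ker G; have := rank_leq_row G; rewrite rk; lia.
Qed.
End Corank1.

(** Twice the Gram matrix: being integral, it can be compared with Cartan matrices by integer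
    arithmetic. *)
Definition cmp2 n (Q : rel 'I_n) : 'M[int]_n :=
  \matrix_(i, j) ((connect Q i j)%:R + (connect Q j i)%:R).

(** The Cartan matrix of [D]. *)
Definition dyn2 (D : dynkin) m : 'M[int]_m :=
  \matrix_(i, j) ((i == j)%:R *+ 2 - (dyn_edge D i j)%:R).

Lemma gramE n (Q : rel 'I_n) : gram Q = 2^-1 *: map_mx intQ (cmp2 Q).
Proof.
by apply/matrixP => i j; rewrite !mxE intrD /poset_le !natz div1r.
Qed.

Lemma dyn_gramE D m : dyn_gram D m = 2^-1 *: map_mx intQ (dyn2 D m).
Proof.
apply/matrixP => i j; rewrite !mxE.
by case: (i == j); case: (dyn_edge D i j); apply/eqP; vm_compute.
Qed.

Lemma gram_sym n (Q : rel 'I_n) : (gram Q)^T = gram Q.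
Proof. by apply/matrixP => i j; rewrite !mxE addrC. Qed.

(** [f] enumerates the vertices that are kept. Row [i] of [B] holds the simple-root coordinates of
    the root attached to [f i], the transpose of the convention in [Dyn_is]. *)
Definition has_type n (Q : rel 'I_n) (m : nat) (f : 'I_m -> 'I_n) (D : dynkin) :=
  [/\ injective f, dyn_size D = m, pos_def (dyn_gram D m) &
      exists B : 'M[int]_m, B \in unitmx /\
        (forall i j, cmp2 Q (f i) (f j) = (B *m dyn2 D m *m B^T) i j)].

Lemma has_type_gram n (Q : rel 'I_n) m (f : 'I_m -> 'I_n) D :
  has_type Q f D -> exists2 B : 'M[int]_m, B \in unitmx &
   (\matrix_(i, j) gram Q (f i) (f j)) =
     map_mx intQ B *m dyn_gram D m *m (map_mx intQ B)^T.
Proof.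
move=> [_ _ _ [B [uB QB]]]; exists B => //.
have -> : (map_mx intQ B)^T = map_mx intQ B^T by apply/matrixP => i j; rewrite !mxE.
rewrite dyn_gramE -scalemxAr -scalemxAl -!map_mxM gramE.
apply/matrixP => i j.
transitivity (2^-1 * (cmp2 Q (f i) (f j))%:~R : rat); first by rewrite !mxE.
by rewrite QB [RHS]mxE [X in _ = _ * X]mxE.
Qed.

Lemma unitmx_intr m (B : 'M[int]_m) : B \in unitmx -> map_mx intQ B \in unitmx.
Proof.
move=> uB; have: map_mx intQ (B *m invmx B) = 1%:M.
  by rewrite mulmxV // map_mx1.
by rewrite map_mxM => /mulmx1_unit[].
Qed.

Lemma has_type_pos n (Q : rel 'I_n) m (f : 'I_m -> 'I_n) D :
  has_type Q f D -> pos_def (\matrix_(i, j) gram Q (f i) (f j)).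
Proof.
move=> QD; have [B uB ->] := has_type_gram QD; have [_ _ pD _] := QD.
by apply: pos_def_congr => //; apply: unitmx_intr.
Qed.

Lemma Dyn_isI n (Q : rel 'I_n) r (f : 'I_(n - r) -> 'I_n) D (k : 'I_r -> 'I_n)
    (h : 'I_r -> 'rV[int]_n) :
  has_type Q f D -> nonneg_corank Q r ->
  (forall a b : 'I_r, (a < b)%N -> (k a < k b)%N) ->
  (forall a, qint Q (h a) = 0) ->
  (forall a b, h a 0 (k b) = (a == b)%:R) ->
  (forall v, qint Q v = 0 -> exists c : 'I_r -> int, v = \sum_(a < r) c a *: h a) ->
  (forall x, (x \in codom f) = (x \notin codom k)) ->
  Dyn_is Q D.
Proof.
move=> QD nnQ kmon h0 hk ker cf; exists r; split=> //; exists k, h.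
have [f_inj sz _ _] := QD; split=> //; exists f; split=> //.
have [B uB e] := has_type_gram QD; exists B^T; rewrite unitmx_tr; split=> //.
by rewrite e; congr (_ *m _ *m _); apply/matrixP => i j; rewrite !mxE.
Qed.

Lemma positive_type n (Q : rel 'I_n) (f : 'I_n -> 'I_n) D :
  has_type Q f D -> positive_poset Q /\ Dyn_is Q D.
Proof.
move=> QD; have [f_inj _ _ _] := QD.
have fcod i : i \in codom f.
  by have [g _ fg] := injF_bij f_inj; apply/codomP; exists (g i).
have form v : 0 <= qform (gram Q) v /\ (qform (gram Q) v = 0 -> v = 0).
  by apply: (pos_def_support f_inj (has_type_pos QD)) => i; rewrite fcod.
have nnQ : nonneg_corank Q 0.
  by split=> [v|]; [case: (form v)|rewrite subn0; apply: pos_def_rank].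
split=> //.
(* ['I_(n - 0)] and ['I_n] are not convertible for a variable [n], so the enumeration is transported
   together with its property. *)
have: exists g : 'I_(n - 0) -> 'I_n, has_type Q g D by rewrite subn0; exists f.
case=> g QDg; have [g_inj _ _ _] := QDg.
apply: (Dyn_isI (k := fun i : 'I_0 => f (widen_ord (leq0n n) i)) (h := fun _ => 0) QDg nnQ).
- by case.
- by case.
- by case.
- move=> v; rewrite /qint => /(form _).2 v0; exists (fun _ => 0).
  rewrite big_ord0; apply/rowP => i; have /rowP/(_ i) := v0.
  by rewrite !mxE => /eqP; rewrite intr_eq0 => /eqP.
- move=> x; transitivity true; last first.
    by apply/esym/negP => /codomP[[]].
  by apply: inj_card_onto => //; rewrite !card_ord subn0.
Qed.

(** Because [h] has entry 1 at [k], an integral null vector is its own [k]-th entry times [h]; thus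
    [h] generates the kernel over Z and not only over Q. *)
Lemma principal_type n (Q : rel 'I_n) m (f : 'I_m -> 'I_n) (k : 'I_n)
    (h : 'rV[int]_n) D :
  has_type Q f D -> n = m.+1 -> (forall i, f i != k) ->
  h 0 k = 1 -> h *m cmp2 Q = 0 -> principal_poset Q /\ Dyn_is Q D.
Proof.
move=> QD nm fk hk hQ; have [f_inj _ _ _] := QD.
have cf i : (i \in codom f) = (i != k).
  have sub : codom f \subset predC1 k.
    by apply/subsetP => _ /codomP[x ->]; rewrite !inE fk.
  have /subset_cardP/(_ sub)/(_ i) : #|codom f| = #|predC1 k|.
    by rewrite card_codom // cardC1 !card_ord nm.
  by rewrite !inE.
pose hq := map_mx intQ h.
have hG : hq *m gram Q = 0.
  by rewrite gramE -scalemxAr -map_mxM hQ map_mx0 scaler0.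
have hqk : hq 0 k = 1 by rewrite mxE hk.
have form := corank1_form f_inj cf (gram_sym Q) hG hqk (has_type_pos QD).
have nnQ : nonneg_corank Q 1.
  split=> [v|]; first by case: (form v).
  exact: corank1_rank f_inj cf (gram_sym Q) hG hqk (has_type_pos QD).
split=> //.
have: exists2 g : 'I_(n - 1) -> 'I_n, has_type Q g D & codom g =i codom f.
  have -> : (n - 1)%N = m by rewrite nm subn1.
  by exists f.
case=> g QDg cg.
apply: (Dyn_isI (k := fun _ : 'I_1 => k) (h := fun _ => h) QDg nnQ).
- by move=> a b; rewrite !ord1.
- by move=> _; rewrite /qint /qform hG mul0mx mxE.
- by move=> a b; rewrite !ord1 hk.
- move=> v; rewrite /qint => /(form _).2 v0; exists (fun _ => v 0 k).
  rewrite big_ord1; apply/rowP => i; have /rowP/(_ i) := v0.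
  by rewrite !mxE -intrM => /eqP; rewrite eqr_int => /eqP.
- move=> x; rewrite cg cf; apply/idP/negP => [/eqP xk /codomP[]//|].
  by move=> nx; apply/eqP => xk; apply: nx; apply/codomP; exists 0.
Qed.

(** * Positivity of the Dynkin forms *)

(** A Gram matrix of Euclidean vectors gives a sum of squares, definite when the rows of [R] are
    independent. The factor [c] admits rescaled roots with integral coordinates. *)
Lemma pos_def_roots D m N (R : 'M[int]_(m, N)) (c : nat) :
  (0 < c)%N -> dyn2 D m *+ c = R *m R^T ->
  (forall v : 'rV[rat]_m, v *m map_mx intQ R = 0 -> v = 0) ->
  pos_def (dyn_gram D m).
Proof.
move=> c0 DR R0.
have -> : dyn_gram D m = (2^-1 / c%:R) *: (map_mx intQ R *m (map_mx intQ R)^T).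
  have -> : (map_mx intQ R)^T = map_mx intQ R^T by apply/matrixP => i j; rewrite !mxE.
  rewrite -map_mxM -DR dyn_gramE; apply/matrixP => i j; rewrite 2!mxE [RHS]mxE [X in _ = _ * X]mxE.
  rewrite mulmxnE rmorphMn /= -[X in _ = _ * X]mulr_natr.
  have: (c%:R : rat) != 0 by rewrite pnatr_eq0 -lt0n.
  by move=> ?; field.
apply: pos_defZ; first by rewrite divr_gt0 ?invr_gt0 ?ltr0n.
move=> v; set w := v *m map_mx intQ R.
have -> : qform (map_mx intQ R *m (map_mx intQ R)^T) v = \sum_j w 0 j ^+ 2.
  rewrite /qform !mulmxA -mulmxA -trmx_mul -/w mxE.
  by apply: eq_bigr => j _; rewrite [X in _ * X]mxE expr2.
split; first by apply: sumr_ge0 => j _; rewrite sqr_ge0.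
move/eqP; rewrite psumr_eq0 => [/allP w0|j _]; last by rewrite sqr_ge0.
apply: R0; apply/rowP => j; rewrite [RHS]mxE; apply/eqP; rewrite -sqrf_eq0.
by apply: w0; rewrite mem_index_enum.
Qed.

Lemma sum_delta (R : pzSemiRingType) N a (F : nat -> R) :
  (a < N)%N -> \sum_(c < N) (c == a :> nat)%:R * F c = F a.
Proof.
move=> aN; rewrite (bigD1 (Ordinal aN)) //= eqxx mul1r big1 ?addr0 // => c.
by rewrite -val_eqE /= => /negPf ->; rewrite mul0r.
Qed.

Definition rootA (i c : nat) : int := (c == i)%:R - (c == i.+1)%:R.

Lemma sum_rootA N i (F : nat -> int) :
  (i.+1 < N)%N -> \sum_(c < N) rootA i c * F c = F i - F i.+1.
Proof.
move=> iN; under eq_bigr do rewrite mulrBl.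
by rewrite sumrB !sum_delta // ltnW.
Qed.

Lemma dyn2A_roots m :
  let R := \matrix_(i < m, c < m.+1) rootA i c in dyn2 (DynA m) m = R *m R^T.
Proof.
apply/matrixP => i j; rewrite !mxE.
under eq_bigr do rewrite !mxE.
rewrite (sum_rootA (rootA j)); last by have := ltn_ord i; lia.
rewrite /rootA /dyn_edge /= -val_eqE /= !natz; lia.
Qed.

(** The functional [F] applied to a linear relation between the rows reads off [K] times its [i]-th
    coefficient. The factor [K] clears the denominators of the dual basis. *)
Lemma dual_free m N (R : 'M[int]_(m, N)) (v : 'rV[rat]_m) :
  (forall i, exists F : 'I_N -> int, exists2 K : int, K != 0 &
     forall j, \sum_c R j c * F c = (j == i)%:R * K) ->
  v *m map_mx intQ R = 0 -> v = 0.
Proof.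
move=> dual vR; apply/rowP => i; rewrite mxE; have [F [K K0 RF]] := dual i.
have : (v *m map_mx intQ R *m (\col_c (F c)%:~R)) 0 0 = 0 by rewrite vR mul0mx mxE.
rewrite -mulmxA mxE.
have RFq j : (map_mx intQ R *m (\col_c (F c)%:~R)) j 0 = ((j == i)%:R * K)%:~R :> rat.
  rewrite mxE -RF rmorph_sum; apply: eq_bigr => c _.
  by rewrite !mxE rmorphM.
under eq_bigr do rewrite RFq.
rewrite (bigD1 i) //= eqxx mul1r big1 ?addr0 => [/eqP|j /negPf ->]; last by rewrite mul0r mulr0.
by rewrite mulf_eq0 intr_eq0 (negPf K0) orbF => /eqP.
Qed.

Lemma pos_def_dynA m : pos_def (dyn_gram (DynA m) m).
Proof.
apply: (pos_def_roots (c := 1)) (dyn2A_roots m) _ => // v; apply: dual_free => i.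
(* The fundamental weight e_0 + ... + e_i. *)
exists (fun c => (c <= i)%N%:R), 1 => // j.
under eq_bigr do rewrite mxE.
rewrite (sum_rootA (fun c => (c <= i)%N%:R)); last by have := ltn_ord j; lia.
rewrite -val_eqE /= !natz; lia.
Qed.

(** The extra vertex of [DynD] hangs at vertex 1, near the start of the path, so its simple root is
    -(e_0 + e_1): orthogonal to e_0 - e_1, with product -1 with e_1 - e_2. *)
Definition rootD (m i c : nat) : int :=
  if i == m.-1 then - (c == 0)%:R - (c == 1)%:R else rootA i c.

Lemma sum_rootD m i (F : nat -> int) : (1 < m)%N -> (i < m)%N ->
  \sum_(c < m) rootD m i c * F c = if i == m.-1 then - F 0 - F 1 else F i - F i.+1.
Proof.
rewrite /rootD => m1 im; case: eqP => e; last by apply: sum_rootA; lia.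
under eq_bigr do rewrite mulrBl mulNr.
by rewrite sumrB sumrN !sum_delta // ltnW.
Qed.

Lemma dyn2D_roots m : (3 < m)%N ->
  let R := \matrix_(i < m, c < m) rootD m i c in dyn2 (DynD m) m = R *m R^T.
Proof.
move=> m3; apply/matrixP => i j; rewrite !mxE.
under eq_bigr do rewrite !mxE.
rewrite (sum_rootD (rootD m j)) //; last lia.
have := ltn_ord i; have := ltn_ord j.
rewrite /rootD /rootA /dyn_edge /= -val_eqE /= !natz; case: ifP => ?; case: ifP; lia.
Qed.

Lemma pos_def_dynD m : (3 < m)%N -> pos_def (dyn_gram (DynD m) m).
Proof.
move=> m3; apply: (pos_def_roots (c := 1)) (dyn2D_roots m3) _ => // v; apply: dual_free => i.
(* Dual vectors of the simple roots. Those of the vertices 0 and [m.-1] have half-integral entries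
   (spin weights) and are rescaled, whence the factors 2 and -2. *)
pose F (c : nat) : int := if i == 0 :> nat then (c == 0)%:R *+ 2 - 1 else
  if i == m.-1 :> nat then 1 else (c <= i)%N%:R - 1.
exists F, (if i == 0 :> nat then 2 else if i == m.-1 :> nat then -2 else 1).
  by case: ifP => //; case: ifP.
move=> j; under eq_bigr do rewrite mxE.
have := ltn_ord j; have := ltn_ord i; rewrite (sum_rootD F) //; last lia.
rewrite -val_eqE /F /= !natz; do !case: ifP => ?; lia.
Qed.

(** * Certificates checked by computation: types E6, E7, E8 *)

Lemma sum_ord_foldr n (F : nat -> int) :
  \sum_(k < n) F k = foldr (fun k s => F k + s) 0 (iota 0 n).
Proof.
rewrite -(big_mkord xpredT) /index_iota subn0 unlock.
by elim: (iota 0 n) => //= k s ->.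
Qed.

Lemma all_ord2 n (P : rel nat) :
  all (fun i => all (P i) (iota 0 n)) (iota 0 n) -> forall i j : 'I_n, P i j.
Proof.
by move=> /allP Pn i j; apply: (allP (Pn i _)); rewrite mem_iota /= add0n ltn_ord.
Qed.

Definition entry (s : seq (seq int)) i j : int := nth 0 (nth [::] s i) j.
(** Matrix product written with [foldr], so that [vm_compute] evaluates it. *)
Definition mulf n (f g : nat -> nat -> int) i j : int :=
  foldr (fun k s => f i k * g k j + s) 0 (iota 0 n).
Definition dynf D i j : int := (i == j :> nat)%:R *+ 2 - (dyn_edge D i j)%:R.

Lemma mul_matrix m n p (f g : nat -> nat -> int) :
  (\matrix_(i < m, j < n) f i j) *m (\matrix_(i < n, j < p) g i j) =
  \matrix_(i, j) mulf n f g i j.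
Proof.
apply/matrixP => i j; rewrite !mxE /mulf -(sum_ord_foldr n (fun k => f i k * g k j)).
by apply: eq_bigr => k _; rewrite !mxE.
Qed.

Lemma eq_matrixf n (f g : nat -> nat -> int) :
  all (fun i => all (fun j => f i j == g i j) (iota 0 n)) (iota 0 n) ->
  \matrix_(i < n, j < n) f i j = \matrix_(i, j) g i j.
Proof.
by move=> /all_ord2 fg; apply/matrixP => i j; rewrite !mxE; apply/eqP/fg.
Qed.

(* The simple roots of E8 in doubled standard coordinates; the first 6 or 7 span E6, E7. *)
Definition rootsE : seq (seq int) :=
 [:: [:: 0; -2; 2; 0; 0; 0; 0; 0]; [:: 2; 2; 0; 0; 0; 0; 0; 0];
     [:: -2; 2; 0; 0; 0; 0; 0; 0]; [:: 1; -1; -1; -1; -1; -1; -1; 1];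
     [:: 0; 0; -2; 2; 0; 0; 0; 0]; [:: 0; 0; 0; -2; 2; 0; 0; 0];
     [:: 0; 0; 0; 0; -2; 2; 0; 0]; [:: 0; 0; 0; 0; 0; -2; 2; 0]].

(** [N] certifies independence of the roots: it is [K] times the inverse Cartan matrix, with [K] the
    determinant (3, 2, 1 for E6, E7, E8). The factor 4 comes from doubling the coordinates. *)
Lemma pos_def_E_check D m (N : seq (seq int)) (K : int) : K != 0 ->
  all (fun i => all (fun j =>
    dynf D i j *+ 4 == mulf 8 (entry rootsE) (fun a b => entry rootsE b a) i j)
      (iota 0 m)) (iota 0 m) ->
  all (fun i => all (fun j =>
    mulf m (dynf D) (entry N) i j == (i == j)%:R * K) (iota 0 m)) (iota 0 m) ->
  pos_def (dyn_gram D m).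
Proof.
move=> K0 cR cN; pose R : 'M[int]_(m, 8) := \matrix_(i, j) entry rootsE i j.
have RT : R^T = \matrix_(i, j) entry rootsE j i by apply/matrixP => i j; rewrite !mxE.
have DR : dyn2 D m *+ 4 = R *m R^T.
  rewrite RT (mul_matrix _ _ _ (entry rootsE) (fun a b => entry rootsE b a)).
  rewrite -(eq_matrixf cR); apply/matrixP => i j.
  by rewrite mulmxnE !mxE.
have DN : dyn2 D m *m (\matrix_(i, j) entry N i j) = K%:M.
  rewrite (_ : dyn2 D m = \matrix_(i, j) dynf D i j); last first.
    by apply/matrixP => i j; rewrite !mxE.
  rewrite mul_matrix (eq_matrixf cN); apply/matrixP => i j; rewrite !mxE -val_eqE.
  by case: eqP; rewrite ?mul1r ?mul0r.
apply: (pos_def_roots _ DR) => // v vR.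
have vD: v *m map_mx intQ (dyn2 D m *+ 4) = 0 by rewrite DR map_mxM mulmxA vR mul0mx.
have: v *m map_mx intQ (dyn2 D m *+ 4) *m map_mx intQ (\matrix_(i < m, j < m) entry N i j) = 0.
  by rewrite vD mul0mx.
rewrite -mulmxA -map_mxM -scaler_nat -scalemxAl DN scale_scalar_mx map_scalar_mx.
by rewrite mul_mx_scalar => /eqP; rewrite scaler_eq0 intr_eq0 mulf_eq0 (negPf K0) => /eqP.
Qed.

Lemma pos_def_E6 : pos_def (dyn_gram DynE6 6).
Proof.
by apply: (@pos_def_E_check _ _ [:: [:: 18; 9; 12; 6; 12; 6]; [:: 9; 6; 6; 3; 6; 3];
    [:: 12; 6; 10; 5; 8; 4]; [:: 6; 3; 5; 4; 4; 2]; [:: 12; 6; 8; 4; 10; 5];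
    [:: 6; 3; 4; 2; 5; 4]] 3); vm_compute.
Qed.

Lemma pos_def_E7 : pos_def (dyn_gram DynE7 7).
Proof.
by apply: (@pos_def_E_check _ _ [:: [:: 24; 12; 16; 8; 18; 12; 6]; [:: 12; 7; 8; 4; 9; 6; 3];
    [:: 16; 8; 12; 6; 12; 8; 4]; [:: 8; 4; 6; 4; 6; 4; 2]; [:: 18; 9; 12; 6; 15; 10; 5];
    [:: 12; 6; 8; 4; 10; 8; 4]; [:: 6; 3; 4; 2; 5; 4; 3]] 2); vm_compute.
Qed.

Lemma pos_def_E8 : pos_def (dyn_gram DynE8 8).
Proof.
by apply: (@pos_def_E_check _ _ [:: [:: 30; 15; 20; 10; 24; 18; 12; 6];
    [:: 15; 8; 10; 5; 12; 9; 6; 3]; [:: 20; 10; 14; 7; 16; 12; 8; 4];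
    [:: 10; 5; 7; 4; 8; 6; 4; 2]; [:: 24; 12; 16; 8; 20; 15; 10; 5];
    [:: 18; 9; 12; 6; 15; 12; 8; 4]; [:: 12; 6; 8; 4; 10; 8; 6; 3];
    [:: 6; 3; 4; 2; 5; 4; 3; 2]] 1); vm_compute.
Qed.

Definition congruent D m (g : nat -> nat -> int) : Prop :=
  exists B : 'M[int]_m, B \in unitmx /\
    forall i j : 'I_m, g i j = (B *m dyn2 D m *m B^T) i j.

(* Row [i] of [B] lists the simple-root coordinates of the root attached to vertex
   [i]; [C] is the inverse of [B]. *)
Lemma congruent_check D m (B C : seq (seq int)) g :
  all (fun i => all (fun j =>
    mulf m (entry B) (entry C) i j == (i == j)%:R) (iota 0 m)) (iota 0 m) ->
  all (fun i => all (fun j =>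
    g i j == mulf m (mulf m (entry B) (dynf D)) (fun a b => entry B b a) i j)
    (iota 0 m)) (iota 0 m) ->
  congruent D m g.
Proof.
move=> cC cg; pose BM : 'M[int]_m := \matrix_(i, j) entry B i j; exists BM; split.
  suff: BM *m (\matrix_(i, j) entry C i j) = 1%:M by case/mulmx1_unit.
  rewrite mul_matrix (eq_matrixf cC); apply/matrixP => i j.
  by rewrite !mxE -val_eqE.
have -> : BM^T = \matrix_(i, j) entry B j i by apply/matrixP => i j; rewrite !mxE.
rewrite (_ : dyn2 D m = \matrix_(i, j) dynf D i j); last first.
  by apply/matrixP => i j; rewrite !mxE.
rewrite mul_matrix (mul_matrix _ _ _ _ (fun a b => entry B b a)) => i j.
by have /matrixP/(_ i j) := eq_matrixf cg; rewrite !mxE.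
Qed.

(** Reachability in [abar p r] in closed form. The numbering is a linear extension; given [i <= j],
    the last two alternatives keep both vertices off the opposite chain. *)
Definition abar_le (p r i j : nat) : bool :=
  (i <= j)%N && [|| i == 0, j == (p + r).-1, (j < p)%N | (p <= i)%N].
Definition abar_cmp p r i j : int := (abar_le p r i j)%:R + (abar_le p r j i)%:R.

Lemma congruent_E6 : congruent DynE6 6 (abar_cmp 3 3).
Proof.
by apply: (@congruent_check _ _ 
 [:: [:: 0; 0; 0; 0; 0; -1]; [:: 0; 0; 0; 0; 1; 0]; [:: 1; 0; 0; 0; 1; 0];
    [:: -1; 0; -1; 0; -1; -1]; [:: -1; 0; -1; -1; -1; -1]; [:: 1; 1; 0; 0; 1; 0]]
 [:: [:: 0; -1; 1; 0; 0; 0]; [:: 0; 0; -1; 0; 0; 1]; [:: 1; 0; -1; -1; 0; 0];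
    [:: 0; 0; 0; 1; -1; 0]; [:: 0; 1; 0; 0; 0; 0]; [:: -1; 0; 0; 0; 0; 0]]);
 vm_compute.
Qed.

Lemma congruent_E7 : congruent DynE7 7 (abar_cmp 4 3).
Proof.
by apply: (@congruent_check _ _ 
[:: [:: 0; 0; 0; 0; 1; 0; 0]; [:: 0; 0; 0; 0; 0; -1; 0]; [:: 0; 0; 0; 0; 0; -1; -1];
    [:: 1; 0; 0; 0; 1; 0; 0]; [:: -1; 0; -1; 0; 0; 0; 0]; [:: -1; 0; -1; -1; 0; 0; 0];
    [:: 1; 1; 0; 0; 1; 0; 0]]
[:: [:: -1; 0; 0; 1; 0; 0; 0]; [:: 0; 0; 0; -1; 0; 0; 1]; [:: 1; 0; 0; -1; -1; 0; 0];
    [:: 0; 0; 0; 0; 1; -1; 0]; [:: 1; 0; 0; 0; 0; 0; 0]; [:: 0; -1; 0; 0; 0; 0; 0];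
    [:: 0; 1; -1; 0; 0; 0; 0]]);
 vm_compute.
Qed.

Lemma congruent_E8 : congruent DynE8 8 (abar_cmp 5 3).
Proof.
by apply: (@congruent_check _ _ 
[:: [:: -1; 0; 0; 0; 0; 0; 0; 0]; [:: 0; 1; 0; 0; 0; 0; 0; 0]; [:: -1; 0; 0; 0; -1; 0; 0; 0];
    [:: -1; 0; 0; 0; -1; -1; 0; 0]; [:: -1; 0; 0; 0; -1; -1; -1; 0];
    [:: 0; 0; 0; 0; 1; 1; 1; 1]; [:: 4; 2; 3; 1; 4; 3; 2; 1]; [:: 1; 1; 1; 0; 1; 1; 1; 1]]
[:: [:: -1; 0; 0; 0; 0; 0; 0; 0]; [:: 0; 1; 0; 0; 0; 0; 0; 0]; [:: 1; -1; 0; 0; 0; -1; 0; 1];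
    [:: -2; 1; 1; 1; 1; 2; 1; -3]; [:: 1; 0; -1; 0; 0; 0; 0; 0]; [:: 0; 0; 1; -1; 0; 0; 0; 0];
    [:: 0; 0; 0; 1; -1; 0; 0; 0]; [:: -1; 0; 0; 0; 1; 1; 0; 0]]);
 vm_compute.
Qed.

(** * Oriented paths *)

(** If the Cartan matrix is R R^T, then B R R^T B^T is the Gram matrix of the rows of [M] = B R.
    Inner products are thus computed in ambient coordinates, where each root has two nonzero entries
    for types A and D. *)
Lemma congruent_roots D m N (r b : nat -> nat -> int) (M g : nat -> nat -> int) :
  (\matrix_(i < m, j < m) b i j) \in unitmx ->
  dyn2 D m = (\matrix_(i < m, c < N) r i c) *m (\matrix_(i < m, c < N) r i c)^T ->
  (forall i c, (i < m)%N -> (c < N)%N -> \sum_(k < m) b i k * r k c = M i c) ->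
  (forall i j, (i < m)%N -> (j < m)%N -> \sum_(c < N) M i c * M j c = g i j) ->
  congruent D m g.
Proof.
move=> uB DR BR MM; exists (\matrix_(i < m, j < m) b i j); split=> // i j.
rewrite DR !mulmxA -mulmxA -trmx_mul mxE -MM //; apply: eq_bigr => c _.
rewrite [X in _ = _ * X]mxE; congr (_ * _).
  by rewrite mxE -BR //; apply: eq_bigr => k _; rewrite !mxE.
by rewrite mxE -BR //; apply: eq_bigr => k _; rewrite !mxE.
Qed.

(** [o k] orients the edge between [k] and [k.+1], true meaning upwards; [mono o i j] is the
    existence of a directed path from [i] to [j]. *)
Definition mono (o : nat -> bool) (i j : nat) : bool :=
  if (i <= j)%N then all o (iota i (j - i)) else all (fun k => ~~ o k) (iota j (i - j)).
Definition path_cmp o i j : int := (mono o i j)%:R + (mono o j i)%:R.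

Lemma monoP (o : nat -> bool) i j : (i <= j)%N ->
  reflect (forall k, (i <= k < j)%N -> o k) (mono o i j).
Proof.
move=> ij; rewrite /mono ij; apply: (iffP allP) => H k; move: (H k); rewrite mem_iota.
  by move=> + kij; apply; lia.
by move=> + kij; apply; lia.
Qed.

Lemma monoNP (o : nat -> bool) i j : (i <= j)%N ->
  reflect (forall k, (i <= k < j)%N -> ~~ o k) (mono o j i).
Proof.
move=> ij; rewrite /mono; case: leqP => ji.
  have -> : i = j by lia.
  by rewrite subnn; apply: ReflectT => k; lia.
apply: (iffP allP) => H k; move: (H k); rewrite mem_iota.
  by move=> + kij; apply; lia.
by move=> + kij; apply; lia.
Qed.

Lemma monoS o i j : (i <= j)%N -> mono o i j.+1 = mono o i j && o j.
Proof.
move=> ij; apply/(monoP o (leqW ij))/andP => [H|[/(monoP o ij) H oj] k kij].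
  split; last by apply: H; lia.
  by apply/monoP => // k kij; apply: H; lia.
by have [->//|kj] := eqVneq k j; apply: H; lia.
Qed.

Lemma monoSN o i j : (i <= j)%N -> mono o j.+1 i = mono o j i && ~~ o j.
Proof.
move=> ij; apply/(monoNP o (leqW ij))/andP => [H|[/(monoNP o ij) H oj] k kij].
  split; last by apply: H; lia.
  by apply/monoNP => // k kij; apply: H; lia.
by have [->//|kj] := eqVneq k j; apply: H; lia.
Qed.

Lemma mono_refl o i : mono o i i.
Proof. by rewrite /mono leqnn subnn. Qed.

(* Vertex [v] of an oriented path is sent to the root [+-(e_(run v) - e_(v+1))],
   where the coordinate [run v] stands for the maximal monotone run entering [v]. *)
Definition turn (o : nat -> bool) v := if v is v'.+1 then o v' != o v else true.
(** A run that starts at vertex u carries the label u+1, the second coordinate of the root of u;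
    this is how u meets all vertices of the run it starts. *)
Fixpoint run o v := if v is v'.+1 then if turn o v' then v else run o v' else 0%N.
(** The direction of the edge entering [v]. It flips after a turn, correcting the product -1 between
    the turning vertex and the run it starts. No edge enters 0, whose sign is opposite to the
    direction of its leaving edge. *)
Definition run_sign (o : nat -> bool) v : int :=
  if v is v'.+1 then if o v' then 1 else -1 else if o 0%N then -1 else 1.

Lemma run_le o v : (run o v <= v)%N.
Proof. by elim: v => //= v IH; case: ifP => // _; apply: leqW. Qed.

Lemma run_sign2 o v : run_sign o v * run_sign o v = 1.
Proof. by case: v => [|v] /=; case: ifP. Qed.

(** The right side is the inner product of the two signed roots: for u < v the coordinate v+1
    exceeds both coordinates of u, so only [run o v] can be shared. *)
Lemma path_cmp_run o u v : (u < v)%N ->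
  path_cmp o u v = run_sign o u * run_sign o v *
    ((run o u == run o v)%:R - (run o v == u.+1)%:R).
Proof.
rewrite /path_cmp; elim: v => // v IH; rewrite ltnS leq_eqVlt => /predU1P[<-|uv].
  rewrite monoS // monoSN // !mono_refl /=; have := run_le o u; clear IH.
  case: u => [|u] /= ru; first by case: (o 0%N).
  move: ru; set ru := (if turn o u then _ else _) => ru_le.
  have ru' : (ru == u.+2) = false by lia.
  have [<-|ou] := eqVneq (o u) (o u.+1) => /=; first by rewrite eqxx ru'; case: (o u).
  by rewrite ru' eqxx; move: ou; case: (o u); case: (o u.+1).
case: v uv IH => // v uv IH.
rewrite (monoS o (ltnW uv)) (monoSN o (ltnW uv)) -[run o v.+2]/(if turn o v.+1 then v.+2 else run o v.+1).
rewrite -[turn o v.+1]/(o v != o v.+1) -[run_sign o v.+2]/(if o v.+1 then 1 else -1).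
have [ov|ov] := eqVneq (o v) (o v.+1).
  have -> : (if o v.+1 then 1 else -1) = run_sign o v.+1 :> int by rewrite -ov.
  rewrite /= -IH //.
  by rewrite -ov !monoS ?monoSN //; case: (o v); rewrite ?andbT ?andbF.
rewrite monoS ?monoSN //; have -> : (v.+2 == u.+1) = false by lia.
have -> : (run o u == v.+2) = false by have := run_le o u; lia.
by move: ov; case: (o v); case: (o v.+1); rewrite /= ?andbF ?subrr ?mulr0.
Qed.

Lemma sum_delta_lt N a (F : nat -> int) :
  \sum_(c < N) F c * (c == a :> nat)%:R = (a < N)%N%:R * F a.
Proof.
case: ltnP => aN.
  by under eq_bigr do rewrite mulrC; rewrite sum_delta ?mul1r.
rewrite mul0r big1 // => c _; rewrite (_ : (_ == _) = false) ?mulr0 //.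
by have := ltn_ord c; lia.
Qed.

Lemma sum_delta_succ N a (F : nat -> int) : (a <= N)%N ->
  \sum_(c < N) F c * (a == c.+1)%:R = (0 < a)%N%:R * F a.-1.
Proof.
case: a => [|a] aN; first by rewrite big1 ?mul0r // => c _; rewrite mulr0.
under eq_bigr do rewrite eqSS eq_sym.
by rewrite sum_delta_lt aN.
Qed.

Lemma congruent_path o m : congruent (DynA m) m (path_cmp o).
Proof.
(* e_(run v) - e_(v+1) telescopes into the simple roots with indices from [run o v] to [v]; the
   matrix is therefore triangular with diagonal entries 1 or -1. *)
pose b (v i : nat) : int := run_sign o v * ((run o v <= i <= v)%N)%:R.
pose M (v c : nat) : int := run_sign o v * ((c == run o v)%:R - (c == v.+1)%:R).
have bE v i : b v i = run_sign o v * ((run o v <= i <= v)%N)%:R by [].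
apply: (@congruent_roots _ _ m.+1 rootA b M).
- rewrite unitmxE det_trig.
    rewrite rpred_prod // => i _; rewrite mxE bE run_le leqnn mulr1.
    by apply/unitrPr; exists (run_sign o i); rewrite run_sign2.
  apply/is_trig_mxP => i j ij; rewrite mxE bE.
  by rewrite [(j <= i)%N]leqNgt ij andbF mulr0.
- exact: dyn2A_roots.
- move=> v c vm cm; rewrite /M; under eq_bigr do rewrite bE -mulrA /rootA mulrBr.
  rewrite -mulr_sumr sumrB (sum_delta_succ (fun k => ((run o v <= k <= v)%N)%:R)) //.
  under eq_bigr do rewrite eq_sym.
  rewrite (sum_delta_lt _ _ (fun k => ((run o v <= k <= v)%N)%:R)).
  congr (_ * _); have := run_le o v; rewrite /= !natz; lia.
move=> u v um vm.
have -> : \sum_(c < m.+1) M u c * M v c = run_sign o u * (M v (run o u) - M v u.+1).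
  rewrite /M; under eq_bigr => c _ do rewrite -mulrA mulrBl.
  rewrite -mulr_sumr sumrB !(sum_delta (fun c => M v c)) //.
  by have := run_le o u; lia.
have ru := run_le o u; have rv := run_le o v.
rewrite /M -mulrBr mulrA; have [uv|vu|uv] := ltngtP u v.
- rewrite path_cmp_run //; congr (_ * _).
  by rewrite [u.+1 == _]eq_sym !natz; lia.
- rewrite (_ : path_cmp o u v = path_cmp o v u); last by rewrite /path_cmp addrC.
  rewrite path_cmp_run //.
  by rewrite [run_sign o u * _]mulrC; congr (_ * _); rewrite !natz; lia.
by rewrite -uv run_sign2 /path_cmp mono_refl mul1r !natz; lia.
Qed.

(* The bottom goes to [-(e_0 + e_1)], the top to [-(e_0 + e_2)], the vertex [i] of
   the long chain to [-(e_0 + e_(i+2))] and the middle vertex to [-(e_1 + e_2)]. *)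
Lemma congruent_D m : (3 < m)%N -> congruent (DynD m) m (abar_cmp (m - 2) 2).
Proof.
move=> m3.
pose t i := if i == 0%N then 0%N else if (m - 2 <= i)%N then 1%N else i.+1.
pose y (i : nat) : int := (i == m - 2)%N%:R.
(* The last simple root plus those of indices 1,...,t telescopes to -(e_0 + e_(t+1)). Adding the
   simple root 0 replaces e_0 by e_1, as the middle vertex requires. *)
pose b (i k : nat) : int := (k == m.-1)%:R + (0 < k <= t i)%N%:R + (k == 0)%:R * y i.
pose x i : nat := i == (m - 2)%N.
pose z i := if i == 0%N then 1%N else if (m - 2 <= i)%N then 2%N else i.+2.
pose M (i c : nat) : int := - (c == x i)%:R - (c == z i)%:R.
apply: (@congruent_roots _ _ m (rootD m) b M).
(* The inverse of [b]: the simple root [k] is the root of vertex [p k] minus that of vertex [q k],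
   except the last one, which is the root of vertex 0. *)
- pose p k := if k == m.-1 then 0%N else if k == 0%N then (m - 2)%N
              else if k == 1%N then m.-1 else k.-1.
  pose q k := if k == 1%N then 0%N else if (k == 0%N) || (k == 2) then m.-1 else (k - 2)%N.
  pose C : 'M[int]_m := \matrix_(k, i) ((i == p k :> nat)%:R - (k != m.-1 :> nat)%:R * (i == q k :> nat)%:R).
  suff: C *m (\matrix_(i < m, j < m) b i j) = 1%:M by case/mulmx1_unit.
  apply/matrixP => k l; rewrite !mxE.
  under eq_bigr do rewrite !mxE mulrBl -mulrA.
  have km := ltn_ord k; have lm := ltn_ord l.
  rewrite sumrB -mulr_sumr !(sum_delta (fun i => b i l)); last 2 first.
  + by rewrite /q; do !case: ifP; lia.
  + by rewrite /p; do !case: ifP; lia.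
  rewrite -val_eqE /b /y /= /t /p /q; case: (eqVneq (k : nat) m.-1) => ke; case: (eqVneq (l : nat) 0%N) => le;
    rewrite ?mul0r ?mul1r !natz;
    do !case: ifP; rewrite ?eqxx; lia.
- exact: dyn2D_roots.
- move=> i c im cm; rewrite /b.
  under eq_bigr do rewrite 2!mulrDl -mulrA.
  rewrite 2!big_split /= (sum_delta (fun k => rootD m k c)); last lia.
  rewrite (sum_delta (fun k => y i * rootD m k c)); last lia.
  have -> : \sum_(k < m) (0 < k <= t i)%N%:R * rootD m k c =
     \sum_(k < m) (0 < k <= t i)%N%:R * (k == c :> nat)%:R -
     \sum_(k < m) (0 < k <= t i)%N%:R * (c == k.+1)%:R :> int.
    rewrite -sumrB; apply: eq_bigr => k _; rewrite -mulrBr /rootD /rootA [c == k]eq_sym.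
    case: eqP => // e; have -> : (0 < k <= t i)%N = false by rewrite /t; do ?case: ifP; lia.
    by rewrite !mul0r.
  rewrite (sum_delta_lt _ _ (fun k => (0 < k <= t i)%N%:R)).
  rewrite (sum_delta_succ (fun k => (0 < k <= t i)%N%:R)); last lia.
  rewrite /y /rootD /rootA /M /x /z /t cm eqxx !natz; do !case: ifP; lia.
move=> i j im jm.
have -> : \sum_(c < m) M i c * M j c = - M j (x i) - M j (z i).
  rewrite /M; under eq_bigr => c _ do rewrite mulrBl mulNr.
  rewrite sumrB sumrN !(sum_delta (M j)) //; rewrite /x /z; do ?case: ifP; lia.
rewrite /M /abar_cmp /abar_le /x /z !natz; do !case: ifP; lia.
Qed.

(** * The digraphs abar p r *)

Lemma connect_homo (T U : finType) (e : rel T) (e' : rel U) (f : T -> U) x y :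
  (forall x y, e x y -> e' (f x) (f y)) -> connect e x y -> connect e' (f x) (f y).
Proof.
move=> ef /connectP[p ep ->]; apply/connectP; exists (map f p); last by rewrite last_map.
by rewrite path_map; apply: sub_path ep => a b; apply: ef.
Qed.

Lemma connect_first (T : finType) (e : rel T) x y :
  connect e x y -> x != y -> exists2 z, e x z & connect e z y.
Proof.
case/connectP => [[|z p] /= ]; first by move=> _ ->; rewrite eqxx.
by case/andP=> xz zp -> _; exists z => //; apply/connectP; exists p.
Qed.

Lemma connect_invariant (T : finType) (e : rel T) (P : pred T) x y :
  (forall a b, P a -> e a b -> P b) -> connect e x y -> P x -> P y.
Proof.
move=> Pe /connectP[p ep ->]; elim: p x ep => //= z p IH x /andP[xz zp] Px.
exact: IH zp (Pe _ _ Px xz).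
Qed.

(** A covering pair is joined by a directed path whose first arrow must already end at the upper
    vertex; conversely, the second hypothesis says that every arrow is a cover. *)
Lemma hasseE n (Q : rel 'I_n) : acyclic_dg Q ->
  (forall i j k, Q i j -> connect Q i k -> connect Q k j -> (k == i) || (k == j)) ->
  hasse Q =2 Q.
Proof.
move=> acy cov i j; apply/and3P/idP => [[ij cij /forallP H]|qij].
  have [z iz zj] := connect_first cij ij.
  have := H z; rewrite (connect1 iz : poset_le Q i z) [poset_le Q z j]zj !andbT negb_and !negbK.
  case/orP => [/eqP zi|/eqP <- //].
  by move: (acy _ _ iz); rewrite zi connect0.
have ij : i != j by apply/eqP => ij; move: (acy _ _ qij); rewrite ij connect0.
split=> //; first exact: connect1.
apply/forallP => k; apply/negP => /and4P[ki kj cik ckj].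
by have := cov _ _ _ qij cik ckj; rewrite (negPf ki) (negPf kj).
Qed.

Section Iso.
Variables (n : nat) (Q Q' : rel 'I_n) (s : {perm 'I_n}).
Hypothesis QQ' : forall i j, Q i j = Q' (s i) (s j).

Lemma iso_connect i j : connect Q i j = connect Q' (s i) (s j).
Proof.
apply/idP/idP => [|c]; first by apply: connect_homo => x y; rewrite QQ'.
rewrite -[i](permK s) -[j](permK s); apply: connect_homo c => x y.
by rewrite QQ' !permKV.
Qed.

Lemma iso_cmp2 i j : cmp2 Q ((s^-1)%g i) ((s^-1)%g j) = cmp2 Q' i j.
Proof. by rewrite !mxE !iso_connect !permKV. Qed.

Lemma iso_cmp2_perm i j : cmp2 Q i j = cmp2 Q' (s i) (s j).
Proof. by rewrite !mxE !iso_connect. Qed.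
End Iso.

(** For r = 1 the vertex [p] is the top, so the third clause becomes the arrow from bottom to top
    and the fourth is empty. *)
Definition abar_arrow (p r i j : nat) : bool :=
  [|| (j == i.+1) && (j < p)%N, (i == p.-1) && (j == (p + r).-1),
      (i == 0%N) && (j == p) | [&& (p <= i)%N, j == i.+1 & (j < p + r)%N]].

Lemma mem_zip_iota a m z i j : (0 < m)%N ->
  let c := rcons (iota a m) z in
  ((i, j) \in zip c (behead c)) =
  [&& (a <= i)%N, (i.+1 < a + m)%N & j == i.+1] || (i == (a + m).-1) && (j == z).
Proof.
case: m => // m _; elim: m a => [|m IH] a /=.
  by rewrite inE xpair_eqE addn1 /=; lia.
have := IH a.+1; rewrite /= inE xpair_eqE => ->; lia.
Qed.

Lemma abarE n p r (i j : 'I_n) : (0 < r)%N -> (r <= p)%N -> (p + r)%N = n ->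
  abar p r i j = abar_arrow p r i j.
Proof.
move=> r0 rp prn; rewrite /abar /abar_arrows mem_cat mem_zip_iota; last lia.
have im := ltn_ord i; have jm := ltn_ord j.
have [r1|r1] := eqVneq r 1%N.
  by rewrite r1 /= inE xpair_eqE /abar_arrow; lia.
have -> : zip (0%N :: rcons (iota p (r - 1)%N) (p + r - 1)%N)
     (behead (0%N :: rcons (iota p (r - 1)%N) (p + r - 1)%N)) =
   (0%N, p) :: let c := rcons (iota p (r - 1)%N) (p + r - 1)%N in zip c (behead c).
  by case: r r0 r1 {rp prn} => [|[|r]] //= _ _; rewrite subn1.
rewrite inE mem_zip_iota ?xpair_eqE /abar_arrow; last lia.
have -> : [&& 0 <= i, i.+1 < 0 + p & j == i.+1 :> nat]%N = (j == i.+1 :> nat) && (j < p)%N by lia.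
have -> : [&& p <= i, i.+1 < p + (r - 1) & j == i.+1 :> nat]%N
    || (i == (p + (r - 1)).-1 :> nat) && (j == p + r - 1 :> nat)%N =
  [&& (p <= i)%N, j == i.+1 :> nat & (j < p + r)%N] by lia.
by rewrite add0n subn1 -!orbA.
Qed.

(** Closure under arrows bounds reachability from above; for the converse, the last arrow into [y]
    comes from a smaller number, which allows induction on [y]. *)
Lemma connect_ltn n (e le : rel 'I_n) :
  (forall x, le x x) -> (forall x y z, le x y -> e y z -> le x z) ->
  (forall x y, le x y -> x != y -> exists z : 'I_n, [/\ le x z, e z y & (z < y)%N]) ->
  connect e =2 le.
Proof.
move=> le0 leS leP x y; apply/idP/idP => [cxy|].
  by apply: (connect_invariant (P := le x) _ cxy) => // a b; apply: leS.
have [N] := ubnP (y : nat); elim: N y => // N IH y; rewrite ltnS => yN xy.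
have [<-|nxy] := eqVneq x y; first exact: connect0.
have [z [xz zy lzy]] := leP _ _ xy nxy.
by apply: connect_trans (connect1 zy); apply: IH => //; lia.
Qed.

Lemma connect_abar n p r (i j : 'I_n) : (0 < r)%N -> (r <= p)%N -> (p + r)%N = n ->
  connect (abar p r) i j = abar_le p r i j.
Proof.
move=> r0 rp prn.
apply: (@connect_ltn n (abar p r) (fun i j : 'I_n => abar_le p r i j)) => {i j}.
- by move=> x; rewrite /abar_le; have := ltn_ord x; lia.
- move=> x y z; rewrite abarE // /abar_arrow /abar_le.
  by have := ltn_ord x; have := ltn_ord y; have := ltn_ord z; lia.
move=> x y xy; rewrite -val_eqE /= => nxy.
have xm := ltn_ord x; have ym := ltn_ord y.
have arrow z (zn : (z < n)%N) : abar_le p r x z -> (z < y)%N -> abar_arrow p r z y ->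
    exists z : 'I_n, [/\ abar_le p r x z, abar p r z y & (z < y)%N].
  by move=> xz zy azy; exists (Ordinal zn); rewrite abarE.
case/andP: xy => lexy xy; have x_lt_y : (x < y)%N by lia.
have [yp|[[yp r1]|[[yp r1]|yp]]] : (y < p)%N \/ y = p :> nat /\ r != 1%N \/
    y = p :> nat /\ r = 1%N \/ (p < y)%N by lia.
- apply: (arrow y.-1); try lia; first by rewrite /abar_le; lia.
  by apply/or4P/Or41; lia.
- have x0 : x = 0%N :> nat by move: xy => /or4P[] ?; lia.
  apply: (arrow 0%N); try lia; first by rewrite /abar_le x0.
  by apply/or4P/Or43; lia.
- apply: (arrow p.-1); try lia; first by rewrite /abar_le; lia.
  by apply/or4P/Or42; lia.
have [yn|yn] : y = n.-1 :> nat \/ (y < n.-1)%N by lia.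
  have [x1|x1] : (0 < x < p)%N \/ (x = 0%N :> nat \/ (p <= x)%N) by lia.
    apply: (arrow p.-1); try lia; first by rewrite /abar_le; lia.
    by apply/or4P/Or42; lia.
  apply: (arrow y.-1); try lia; first by rewrite /abar_le; lia.
  by apply/or4P/Or44; lia.
have x1 : x = 0%N :> nat \/ (p <= x)%N by move: xy => /or4P[] ?; lia.
apply: (arrow y.-1); try lia; first by rewrite /abar_le; lia.
by apply/or4P/Or44; lia.
Qed.

Lemma cmp2_abar n p r (i j : 'I_n) : (0 < r)%N -> (r <= p)%N -> (p + r)%N = n ->
  cmp2 (abar p r) i j = abar_cmp p r i j.
Proof. by move=> r0 rp prn; rewrite mxE !connect_abar. Qed.

Lemma iso_abar_hasse n (Q : rel 'I_n) p r :
  acyclic_dg Q -> (1 < r)%N -> iso_abar Q p r -> hasse Q =2 Q.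
Proof.
move=> acy r1 [r0 rp prn [s Qs]]; apply: hasseE => // i j k.
rewrite !(iso_connect Qs) Qs !connect_abar // abarE // => H1 H2 H3.
rewrite -[k == i](inj_eq (@perm_inj _ s)) -[k == j](inj_eq (@perm_inj _ s)) -!val_eqE /=.
move: (s i) (s j) (s k) H1 H2 H3 => {}i {}j {}k.
have := ltn_ord i; have := ltn_ord j; have := ltn_ord k.
rewrite /abar_le => kn jn i_n /or4P[/andP[ij _]|/andP[ip jt]|/andP[i0 jp]|/and3P[_ ij _]].
- by move=> /andP[ik _] /andP[kj _]; lia.
- by move=> /andP[ik H] _; move/or4P: H => [] H; lia.
- by move=> _ /andP[kj H]; move/or4P: H => [] H; lia.
by move=> /andP[ik _] /andP[kj _]; lia.
Qed.

Lemma iso_abar1_hasse n (Q : rel 'I_n) :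
  (2 < n)%N -> iso_abar Q (n - 1) 1 -> ~ (hasse Q =2 Q).
Proof.
move=> n2 [_ _ prn [s Qs]] H.
have n0 : (0 < n)%N by lia.
have n1 : (1 < n)%N by lia.
have nn : (n.-1 < n)%N by lia.
pose u k (kn : (k < n)%N) := (s^-1)%g (Ordinal kn).
have su k (kn : (k < n)%N) : s (u k kn) = Ordinal kn by rewrite /u permKV.
have : hasse Q (u _ n0) (u _ nn).
  (* The arrow from bottom to top is not a cover: vertex 1 lies strictly between. *)
  by rewrite H Qs !su abarE //; rewrite /abar_arrow /=; lia.
case/and3P => _ _ /forallP/(_ (u _ n1)); rewrite !(inj_eq (@perm_inj _ _)) -!val_eqE /=.
rewrite /poset_le !(iso_connect Qs) !su !connect_abar //; try lia.
rewrite /abar_le /=; lia.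
Qed.

Lemma iso_abar_positive n (Q : rel 'I_n) p r D :
  iso_abar Q p r -> dyn_size D = n -> pos_def (dyn_gram D n) ->
  congruent D n (abar_cmp p r) -> positive_poset Q /\ Dyn_is Q D.
Proof.
move=> [r0 rp prn [s Qs]] szD pD [B [uB BD]].
apply: (@positive_type _ _ (s^-1)%g); split=> //; first exact: perm_inj.
by exists B; split=> // i j; rewrite (iso_cmp2 Qs) cmp2_abar.
Qed.

Lemma congruent_eq D m (g h : nat -> nat -> int) :
  (forall i j, (i < m)%N -> (j < m)%N -> g i j = h i j) -> congruent D m h -> congruent D m g.
Proof. by move=> gh [B [uB BD]]; exists B; split=> // i j; rewrite gh. Qed.

(** The shortcut from bottom to top adds no comparability, so the order is that of a path with all
    edges pointing up. *)
Lemma congruent_abar1 n : (1 < n)%N -> congruent (DynA n) n (abar_cmp (n - 1) 1).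
Proof.
move=> n1; apply: congruent_eq (congruent_path xpredT n) => i j ilt jlt.
have monoT a b : mono xpredT a b = (a <= b)%N.
  rewrite /mono; case: leqP => ab; first by rewrite all_predT.
  by case E : (a - b)%N => [|c] //=; lia.
by rewrite /abar_cmp /path_cmp !monoT /abar_le; congr (_%:R + _%:R); lia.
Qed.

(* [tau] labels the vertices other than [k]. *)
Lemma iso_abar_principal m (Q : rel 'I_m.+1) p r D (tau : seq nat) (k : nat)
    (h : nat -> int) (g : nat -> nat -> int) :
  iso_abar Q p r -> dyn_size D = m -> pos_def (dyn_gram D m) ->
  congruent D m g -> uniq tau -> size tau = m ->
  all (fun i => all (fun j => g i j == abar_cmp p r (nth 0%N tau i) (nth 0%N tau j))
     (iota 0 m)) (iota 0 m) ->
  all (fun i => (i < m.+1)%N && (i != k)) tau -> (k < m.+1)%N -> h k = 1 ->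
  all (fun j => foldr (fun i s => h i * abar_cmp p r i j + s) 0 (iota 0 m.+1) == 0)
    (iota 0 m.+1) ->
  principal_poset Q /\ Dyn_is Q D.
Proof.
move=> [r0 rp prn [s Qs]] szD pD [B [uB BD]] utau stau cg /allP ctau km hk /allP hg.
have tauP (i : 'I_m) : (nth 0%N tau i < m.+1)%N && (nth 0%N tau i != k).
  by apply: ctau; rewrite mem_nth // stau.
pose f (i : 'I_m) := (s^-1)%g (inord (nth 0%N tau i)).
apply: (@principal_type _ _ _ f ((s^-1)%g (inord k)) (\row_i h (s i))) => //.
- split=> //.
    move=> i j /perm_inj /(congr1 val); rewrite /= !inordK; last 2 first.
    + by case/andP: (tauP j). 
    + by case/andP: (tauP i).
    by move/eqP; rewrite nth_uniq ?stau // => /eqP; apply: val_inj.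
  exists B; split=> // i j; rewrite (iso_cmp2 Qs) cmp2_abar // -BD.
  have /andP[ti _] := tauP i; have /andP[tj _] := tauP j.
  by rewrite !inordK //; apply/esym/eqP; apply: (all_ord2 cg).
- move=> i; rewrite (inj_eq (@perm_inj _ _)) -val_eqE /=.
  by have /andP[ti tk] := tauP i; rewrite !inordK.
- by rewrite mxE permKV inordK.
apply/rowP => j; rewrite mxE [RHS]mxE (reindex_inj (@perm_inj _ (s^-1)%g)) /=.
have := hg (s j); rewrite mem_iota ltn_ord => /(_ isT) /eqP.
rewrite -(sum_ord_foldr _ (fun i => h i * abar_cmp p r i (s j))) => hs.
rewrite -[RHS]hs.
apply: eq_bigr => i _; rewrite mxE permKV; congr (_ * _).
by rewrite (iso_cmp2_perm Qs) permKV cmp2_abar.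
Qed.

Lemma iso_abar44 n (Q : rel 'I_n) : iso_abar Q 4 4 -> principal_poset Q /\ Dyn_is Q DynE7.
Proof.
move=> QA; have [_ _ n8 _] := QA; subst n.
(* The null vector is [neg_vec 4 4] divided by 8. Deleting vertex 1 shortens the first chain, so the
   other one becomes the long chain of [abar 4 3] and is listed first. *)
apply: (@iso_abar_principal 7 Q 4 4 _ [:: 0; 4; 5; 6; 2; 3; 7]%N 1
  (nth 0 [:: -2; 1; 1; 1; 1; 1; 1; -2]) (abar_cmp 4 3)) => //.
- exact: pos_def_E7.
- exact: congruent_E7.
Qed.

Lemma iso_abar63 n (Q : rel 'I_n) : iso_abar Q 6 3 -> principal_poset Q /\ Dyn_is Q DynE8.
Proof.
move=> QA; have [_ _ n9 _] := QA; subst n.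
(* The null vector is [neg_vec 6 3] divided by 6; deleting vertex 1 of the long chain leaves
   [abar 5 3]. *)
apply: (@iso_abar_principal 8 Q 6 3 _ [:: 0; 2; 3; 4; 5; 6; 7; 8]%N 1
  (nth 0 [:: -3; 1; 1; 1; 1; 1; 2; 2; -3]) (abar_cmp 5 3)) => //.
- exact: pos_def_E8.
- exact: congruent_E8.
Qed.

(** * A vector of negative norm on [abar p r] *)

Lemma sum_nat_const_delta (a b i : nat) (c d : int) (F : nat -> int) : (a <= b)%N ->
  (forall j, (a <= j < b)%N -> F j = c + (j == i)%:R * d) ->
  \sum_(a <= j < b) F j = (b - a)%N%:R * c + (a <= i < b)%N%:R * d.
Proof.
move=> + HF; elim: b HF => [|b IH] HF ab.
  have -> : a = 0%N by lia.
  by rewrite big_geq // ltn0 !mul0r addr0.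
have [ba|ab'] := ltnP b a.
  rewrite big_geq //; have -> : (b.+1 - a)%N = 0%N by lia.
  have -> : (a <= i < b.+1)%N = false by lia.
  by rewrite !mul0r addr0.
rewrite big_nat_recr //= IH //; last by move=> j jab; apply: HF; lia.
rewrite HF; last lia.
have -> : (b.+1 - a)%N = (b - a).+1 by lia.
have -> : (a <= i < b.+1)%N = (a <= i < b)%N || (b == i) by lia.
move: (b - a)%N => e; have [<-|bi] := eqVneq b i; last by rewrite orbF mul0r -natr1; ring.
by rewrite (_ : (a <= b < b)%N = false) ?orbT; [rewrite -natr1 /=; ring|lia].
Qed.

(** With equal values at bottom and top and a constant on each chain, orthogonality to all inner
    vertices forces this vector up to scale: on the first chain, (p-1)2r + 2r balances 2pr, and
    symmetrically on the second. *)
Definition neg_vec (p r i : nat) : int :=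
  if (i == 0%N) || (i == (p + r).-1) then - (p%:R * r%:R)
  else if (i < p)%N then 2 * r%:R else 2 * p%:R.

Lemma neg_vec_row (p r i : nat) : (1 < r)%N -> (r <= p)%N -> (i < p + r)%N ->
  \sum_(j < p + r) abar_cmp p r i j * neg_vec p r j =
  ((i == 0%N) || (i == (p + r).-1))%:R * (p%:R * r%:R - 2 * p%:R - 2 * r%:R).
Proof.
move=> r1 rp im; rewrite -(big_mkord xpredT (fun j => abar_cmp p r i j * neg_vec p r j)).
have -> : (p + r = (p + r).-1.+1)%N by lia.
rewrite big_nat_recr //= big_ltn; last lia.
rewrite (@big_cat_nat _ _ _ p) /=; try lia.
pose e := (i == 0%N) || (i == (p + r).-1).
rewrite (@sum_nat_const_delta 1 p i ((e || (i < p)%N)%:R * (2 * r%:R)) (2 * r%:R)); last 2 first.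
- lia.
- move=> j j1p; rewrite /neg_vec.
  have -> : (j == 0%N) || (j == (p + r).-1) = false by lia.
  have -> : (j < p)%N by lia.
  rewrite -mulrDl; congr (_ * _); rewrite /abar_cmp /abar_le /e !natz; lia.
rewrite (@sum_nat_const_delta p (p + r).-1 i ((e || (p <= i)%N)%:R * (2 * p%:R)) (2 * p%:R)); last 2 first.
- lia.
- move=> j jp; rewrite /neg_vec.
  have -> : (j == 0%N) || (j == (p + r).-1) = false by lia.
  have -> : (j < p)%N = false by lia.
  rewrite -mulrDl; congr (_ * _); rewrite /abar_cmp /abar_le /e !natz; lia.
have -> : neg_vec p r 0 = - (p%:R * r%:R) by [].
have -> : neg_vec p r (p + r).-1 = - (p%:R * r%:R) by rewrite /neg_vec eqxx orbT.
have -> : abar_cmp p r i 0 = 1 + (i == 0%N)%:R.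
  rewrite /abar_cmp /abar_le !natz; lia.
have -> : abar_cmp p r i (p + r).-1 = 1 + (i == (p + r).-1)%:R.
  rewrite /abar_cmp /abar_le !natz; lia.
have -> : ((p + r).-1 - p)%N%:R = r%:R - 1 :> int by rewrite !natz; lia.
have -> : (p - 1)%N%:R = p%:R - 1 :> int by rewrite !natz; lia.
rewrite /e; have [i0|i0] := eqVneq i 0%N.
  have -> : (i == (p + r).-1) = false by lia.
  have -> : (0 < i < p)%N = false by lia.
  have -> : (p <= i < (p + r).-1)%N = false by lia.
  by rewrite /=; ring.
have [it|it] := eqVneq i (p + r).-1.
  have -> : (0 < i < p)%N = false by lia.
  have -> : (p <= i < (p + r).-1)%N = false by lia.
  by rewrite /=; ring.
have [ip|ip] : (i < p)%N \/ (p <= i)%N by lia.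
  have -> : (0 < i < p)%N by lia.
  have -> : (p <= i < (p + r).-1)%N = false by lia.
  have -> : (p <= i)%N = false by lia.
  by rewrite ip /=; ring.
have -> : (0 < i < p)%N = false by lia.
have -> : (p <= i < (p + r).-1)%N by lia.
have -> : (i < p)%N = false by lia.
by rewrite ip /=; ring.
Qed.

Lemma qint_cmp2 n (Q : rel 'I_n) (v : 'rV[int]_n) :
  qint Q v = 2^-1 * (\sum_i v 0 i * \sum_j cmp2 Q i j * v 0 j)%:~R.
Proof.
rewrite /qint qformE gramE rmorph_sum mulr_sumr; apply: eq_bigr => i _.
rewrite rmorphM rmorph_sum !mulr_sumr; apply: eq_bigr => j _.
by rewrite rmorphM !mxE /=; ring.
Qed.

Lemma iso_abar_indefinite n (Q : rel 'I_n) p r :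
  iso_abar Q p r -> (1 < r)%N -> (2 * (p + r) < p * r)%N -> indefinite_poset Q.
Proof.
move=> [_ rp prn [s Qs]] r1 pr; subst n.
have p0 : (0 < p)%N by lia.
have cmpE i j : cmp2 Q ((s^-1)%g i) ((s^-1)%g j) = abar_cmp p r i j.
  by rewrite (iso_cmp2 Qs) cmp2_abar // ltnW.
split.
  move=> /(_ (map_mx (fun z : int => z%:~R : rat) (\row_i neg_vec p r (s i)))).
  rewrite -/(qint _ _) qint_cmp2 pmulr_rge0 // ler0z (reindex_inj (@perm_inj _ (s^-1)%g)) /=.
  under eq_bigr => i _.
    rewrite mxE permKV (reindex_inj (@perm_inj _ (s^-1)%g)) /=.
    under eq_bigr => j _ do rewrite cmpE mxE permKV.
    rewrite neg_vec_row //.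
    over.
  have m0 : (0 < p + r)%N by lia.
  have m1 : ((p + r).-1 < p + r)%N by lia.
  (* Only bottom and top have a nonzero row; each contributes -pr(pr - 2p - 2r). *)
  rewrite (bigD1 (Ordinal m0)) //= (bigD1 (Ordinal m1)) /=; last by rewrite -val_eqE /=; lia.
  rewrite big1 => [|i]; last first.
    by rewrite -!val_eqE /= => /andP[/negPf -> /negPf ->]; rewrite mul0r mulr0.
  rewrite eqxx ?orbT /neg_vec /= eqxx ?orbT /= addr0.
  by rewrite !natz; nia.
(* The form is not negative semi-definite, since a basis vector has value 1. *)
have r0 : (0 < p + r)%N by lia.
pose i0 := Ordinal r0.
move=> /(_ (delta_mx 0 i0)); rewrite /qform -rowE.
rewrite trmx_delta -colE !mxE /poset_le !connect0.
by [].
Qed.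

(** * Paths and cycles *)

Local Close Scope ring_scope.

Section Listing.
Variables (T : finType) (e : rel T) (x0 : T).
Hypotheses (e_sym : symmetric e) (e_conn : forall x y, connect e x y).
Hypothesis e_deg : forall x, #|[set y | e x y]| <= 2.

Lemma degree2_neighbours x a b y : e x a -> e x b -> a != b -> e x y -> y \in [:: a; b].
Proof.
move=> xa xb ab xy; apply/negPn/negP; rewrite !inE negb_or => /andP[ya yb].
have := e_deg x; rewrite leqNgt => /negP; apply.
have <- : #|[set y; a; b]| = 3.
  by rewrite -setUA cardsU1 cards2 !inE negb_or ya yb ab.
apply/subset_leq_card/subsetP => z; rewrite !inE => /orP[/orP[]|] /eqP -> //.
Qed.

Lemma longest_path : exists s : seq T, [/\ s != [::], uniq s, sorted e s &
  forall s', uniq s' -> sorted e s' -> size s' <= size s].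
Proof.
pose P k := [exists t : k.-tuple T, uniq t && sorted e t].
have P1 : exists k, P k by exists 1; apply/existsP; exists [tuple x0].
have Pb k : P k -> k <= #|T|.
  case/existsP => t /andP[ut _]; rewrite -(size_tuple t) -(card_uniqP ut).
  exact: max_card.
case: (ex_maxnP P1 Pb) => k /existsP[t /andP[ut st]] kmax.
have tmax s' : uniq s' -> sorted e s' -> size s' <= size t.
  move=> us' ss'; rewrite size_tuple; apply: kmax.
  by apply/existsP; exists (in_tuple s'); rewrite us'.
exists t; split=> //.
by apply/eqP => t0; have := tmax [:: x0] isT isT; rewrite t0.
Qed.

(** The list is a longest path. Inner vertices already have both neighbours on it, and by maximality
    so do the neighbours of its ends; connectedness makes it exhaust [T]. The bit [c] records a
    closing edge, which for two vertices would be the path edge itself. *)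
Lemma listing : exists (s : seq T) (c : bool),
  [/\ uniq s, size s = #|T|, c -> 2 < #|T| &
    forall i j, i < j < #|T| ->
      e (nth x0 s i) (nth x0 s j) = (j == i.+1) || [&& c, i == 0 & j == #|T|.-1]].
Proof.
have [s [s0 us ss smax]] := longest_path.
set N := size s in smax *; pose u := nth x0 s.
have N0 : 0 < N by rewrite lt0n size_eq0.
have uS i : i.+1 < N -> e (u i) (u i.+1) by move: ss => /(sortedP x0); apply.
have uI i j : i < N -> j < N -> (u i == u j) = (i == j) by move=> *; rewrite nth_uniq.
have um i : i < N -> u i \in s by apply: mem_nth.
have inner i y : 0 < i -> i.+1 < N -> e (u i) y -> y \in [:: u i.-1; u i.+1].
  move=> i0 iN; apply: degree2_neighbours; last by rewrite uI; lia.
    by rewrite e_sym; case: i i0 iN => // i _ iN; apply: uS; lia.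
  exact: uS.
have first y : e (u 0) y -> y \in s.
  move=> uy; apply/negPn/negP => ys; have := smax (y :: s); rewrite /= ys us => /(_ isT).
  have -> : path e y s.
    by rewrite e_sym /u in uy; case: (s) s0 ss uy => //= x s' _ -> ->.
  by move=> /(_ isT); rewrite ltnn.
have last_ y : e (u N.-1) y -> y \in s.
  move=> uy; apply/negPn/negP => ys; have := smax (rcons s y).
  rewrite rcons_uniq ys us size_rcons => /(_ isT).
  have : sorted e (rcons s y).
    move: uy; rewrite /u /N nth_last.
    by case: (s) ss s0 => //= x p xp _; rewrite rcons_path xp.
  by move=> -> /(_ isT); rewrite ltnn.
have closed x y : x \in s -> e x y -> y \in s.
  move=> /(nthP x0)[i iN <-]; rewrite -/(u i).
  have [->|i0] := posnP i; first exact: first.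
  have [iN'|iN'] := ltnP i.+1 N.
    by move=> /(inner _ _ i0 iN'); rewrite !inE => /orP[] /eqP ->; apply: um; lia.
  by have -> : i = N.-1 by [rewrite -/N in iN; lia]; apply: last_.
have all_s x : x \in s.
  by apply: (connect_invariant closed (e_conn (u 0) x)); apply: um.
have sT : N = #|T|.
  by rewrite /N -(card_uniqP us); apply/esym/eq_card => x; rewrite all_s.
exists s, (e (u 0) (u N.-1) && (2 < N)); rewrite -sT; split=> //.
  by case/andP.
move=> i j /andP[ij jN]; rewrite -/(u i) -/(u j).
have iN : i < N by lia.
apply/idP/idP => [eij|]; last first.
  case/orP => [/eqP ->|/and3P[/andP[c _] /eqP -> /eqP -> //]]; apply: uS; lia.
have [i0|i0] := posnP i; last first.
  have := inner i (u j) i0 _ eij; rewrite !inE !uI; lia.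
subst i; have [jN'|jN'] := ltnP j.+1 N.
  by rewrite e_sym in eij; have := inner j (u 0) ij jN' eij; rewrite !inE !uI; lia.
have jE : j = N.-1 by lia.
by rewrite jE in eij *; rewrite eij eqxx; lia.
Qed.
End Listing.

Definition cyc_adj n (i j : nat) : bool := (i.+1 %% n == j) || (j.+1 %% n == i).

Lemma cyc_adjE n i j : 2 < n -> i < j < n ->
  cyc_adj n i j = (j == i.+1) || ((i == 0) && (j == n.-1)).
Proof.
move=> n2 /andP[ij jn]; rewrite /cyc_adj (@modn_small i.+1); last lia.
have [jn'|jn'] : j.+1 = n \/ j.+1 < n by lia.
  by rewrite jn' modnn; lia.
rewrite modn_small //; lia.
Qed.

Lemma cyc_adj_irr n i : 2 < n -> i < n -> cyc_adj n i i = false.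
Proof.
move=> n2 im; rewrite /cyc_adj orbb.
have [im'|im'] : i.+1 = n \/ i.+1 < n by lia.
  by rewrite im' modnn; lia.
rewrite modn_small //; lia.
Qed.

Lemma cyc_adjC n i j : cyc_adj n i j = cyc_adj n j i.
Proof. by rewrite /cyc_adj orbC. Qed.

(** Rotation invariance allows the chosen sink to be placed at position 0. *)
Lemma cyc_adj_rot n t i j : i < n -> j < n ->
  cyc_adj n ((i + t) %% n) ((j + t) %% n) = cyc_adj n i j.
Proof.
move=> im jm; have S x : x.+1 %% n = (x + 1) %% n by rewrite addn1.
rewrite /cyc_adj (S ((i + t) %% n)) (S ((j + t) %% n)) (S i) (S j) !modnDml.
have rot a b : b < n -> ((a + t + 1) %% n == (b + t) %% n) = ((a + 1) %% n == b).
  by move=> bn; rewrite addnAC eqn_modDr (modn_small bn).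
by rewrite !rot.
Qed.

Lemma ugraph_sym n (Q : rel 'I_n) : symmetric (ugraph Q).
Proof. by move=> i j; rewrite /ugraph orbC. Qed.

Lemma acyclic_irr n (Q : rel 'I_n) i : acyclic_dg Q -> Q i i = false.
Proof. by move=> acy; apply/negP => /acy; rewrite connect0. Qed.

Lemma acyclic_antisym n (Q : rel 'I_n) i j : acyclic_dg Q -> Q i j -> Q j i = false.
Proof. by move=> acy /acy/negP qij; apply/negP => /connect1. Qed.

Lemma path_or_cycle n (Q : rel 'I_n) : 0 < n -> connected_dg Q -> acyclic_dg Q ->
  (forall i, degree Q i <= 2) -> is_path_graph Q \/ is_cycle_graph Q.
Proof.
move=> n0 conn acy deg; pose x0 := Ordinal n0.
have irr : irreflexive (ugraph Q) by move=> i; rewrite /ugraph acyclic_irr.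
have [s [c [us sn c2 sE]]] := listing x0 (@ugraph_sym _ Q) conn deg.
rewrite card_ord in sn c2 sE.
have w_inj : injective (fun i : 'I_n => nth x0 s i).
  move=> i j /eqP; rewrite nth_uniq ?sn //; by move/eqP/val_inj.
pose w := perm w_inj.
have wE (i j : 'I_n) : i < j -> ugraph Q (w i) (w j) = (j == i.+1 :> nat) || [&& c, i == 0 :> nat & j == n.-1 :> nat].
  by move=> ij; rewrite !permE sE // ij /=.
case: c c2 wE {sE} => [n2|_] wE.
  have {}n2 := n2 isT; right; split; first exact: n2.
  exists (w^-1)%g => i j; rewrite -/(cyc_adj n _ _).
  rewrite -{1}[i](permKV w) -{1}[j](permKV w).
  move: ((w^-1)%g i) ((w^-1)%g j) => {}i {}j.
  have [ij|ji|/val_inj <-] := ltngtP i j.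
  - by rewrite wE // cyc_adjE // ij /=.
  - by rewrite (ugraph_sym Q (w i) (w j)) wE // cyc_adjC cyc_adjE // ji /=.
  by rewrite irr cyc_adj_irr.
left; exists (w^-1)%g => i j.
rewrite -{1}[i](permKV w) -{1}[j](permKV w).
move: ((w^-1)%g i) ((w^-1)%g j) => {}i {}j.
have [ij|ji|/val_inj <-] := ltngtP i j.
- by rewrite wE //=; lia.
- by rewrite (ugraph_sym Q (w i) (w j)) wE //=; lia.
by rewrite irr; lia.
Qed.

Lemma path_not_regular n (Q : rel 'I_n) : 0 < n -> is_path_graph Q -> ~ two_regular Q.
Proof.
move=> n0 [s sE] reg; pose x := (s^-1)%g (Ordinal n0).
have := reg x; rewrite /degree => d2.
have : #|[set j | ugraph Q x j]| <= 1; last by rewrite d2.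
apply/card_le1_eqP => i j; rewrite !inE !sE /x permKV /= => /orP[/eqP i1|/eqP //] /orP[/eqP j1|/eqP //].
by apply: (@perm_inj _ s); apply: val_inj; rewrite /= -i1 -j1.
Qed.

Lemma cycle_regular n (Q : rel 'I_n) : is_cycle_graph Q -> two_regular Q.
Proof.
move=> [n2 [s sE]] i; rewrite /degree.
have n0 : 0 < n by lia.
pose a := (s^-1)%g (Ordinal (ltn_pmod (s i).+1 n0)).
pose b := (s^-1)%g (Ordinal (ltn_pmod (s i + n.-1) n0)).
have -> : [set j | ugraph Q i j] = [set a; b].
  apply/setP => j; rewrite !inE sE; congr (_ || _).
    by rewrite -(inj_eq (@perm_inj _ s)) /a permKV -val_eqE /= eq_sym.
  rewrite -(inj_eq (@perm_inj _ s)) /b permKV -val_eqE /=.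
  have := ltn_ord (s i); have := ltn_ord (s j); move: (s i : nat) (s j : nat) => x y yn xn.
  have -> : (y.+1 %% n == x) = (y.+1 %% n == x %% n) by rewrite (modn_small xn).
  have -> : (y == (x + n.-1) %% n) = ((y + 1) %% n == (x + n.-1 + 1) %% n).
    by rewrite eqn_modDr (modn_small yn).
  by rewrite addn1 -addnA addn1 prednK // modnDr.
rewrite cards2 (inj_eq (@perm_inj _ _)) -val_eqE /=.
suff -> : (s i).+1 %% n != (s i + n.-1) %% n by [].
have := ltn_ord (s i); move: (s i : nat) => x xn.
rewrite -[x.+1]addn1 eqn_modDl !modn_small; lia.
Qed.

(** * Orientations of paths and cycles *)

Definition path_arrow (o : nat -> bool) (i j : nat) : bool :=
  (j == i.+1) && o i || (i == j.+1) && ~~ o j.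

(** An arrow turning back would reverse the edge just traversed, so it can only prolong the run. *)
Lemma mono_arrow o i j k : mono o i j -> path_arrow o j k -> mono o i k.
Proof.
move=> ij /orP[] /andP[/eqP jk oj].
  subst k; have [le_ij|lt_ji] := leqP i j; first by rewrite monoS ?ij.
  by move: ij => /(monoNP o (ltnW lt_ji)) /(_ j); rewrite leqnn lt_ji oj => /(_ isT).
subst j; have [le_ik|lt_ki] := leqP i k.
  by move: ij; rewrite monoS // => /andP[_]; rewrite (negPf oj).
apply/(monoNP o (ltnW lt_ki)) => t tk; have [->//|tk'] := eqVneq t k.
by move: ij => /(monoNP o lt_ki); apply; lia.
Qed.

(** A third vertex on the way from [i] to [j] would lie beyond one of them, and some edge would be
    traversed in both directions. *)
Lemma mono_cover o i j k : path_arrow o i j -> mono o i k -> mono o k j -> k = i \/ k = j.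
Proof.
move=> aij ik kj; have [lki|leik] := ltnP k i.
  move: ik => /(monoNP o (ltnW lki)) ik.
  case/orP: aij => /andP[/eqP e oi].
    have kj' : k <= j by lia.
    move: kj => /(monoP o kj') kj.
    by have := ik k; have := kj k; rewrite leqnn lki; have -> : k < j by [lia]; move=> /(_ isT) -> /(_ isT).
  have [->|kj'] := eqVneq k j; first by right.
  have lekj : k <= j by lia.
  move: kj => /(monoP o lekj) kj.
  by have := ik k; have := kj k; rewrite leqnn lki; have -> : k < j by [lia]; move=> /(_ isT) -> /(_ isT).
have [->|ki] := eqVneq k i; first by left.
have [->|nkj] := eqVneq k j; first by right.
move: ik => /(monoP o leik) ik.
case/orP: aij => /andP[/eqP e oi].
  have jk : j <= k by lia.
  move: kj => /(monoNP o jk) kj.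
  by have := kj j; rewrite ik ?leqnn /=; [move=> /(_ _); lia|lia].
have jk : j <= k by lia.
move: kj => /(monoNP o jk) kj.
by have := kj i; rewrite ik ?leqnn /=; [move=> /(_ _); lia|lia].
Qed.

Lemma mono_shift o i j : mono o i.+1 j.+1 = mono (fun k => o k.+1) i j.
Proof.
rewrite /mono ltnS !subSS; have iS a d : iota a.+1 d = map S (iota a d) by rewrite -(iotaDl 1 a d).
by rewrite !iS !all_map.
Qed.

(** Only an inclusion of arrows is assumed, so the lemma also serves the cycle, which has one arrow
    more. *)
Lemma mono_connect n (e : rel 'I_n) o :
  (forall i j : 'I_n, path_arrow o i j -> e i j) ->
  forall i j : 'I_n, mono o i j -> connect e i j.
Proof.
move=> eo i j; have [N] := ubnP ((i - j) + (j - i)); elim: N j => // N IH j.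
rewrite ltnS => leN mij; have [ij|ji|/val_inj ->] := ltngtP i j; last exact: connect0.
  have kn : j.-1 < n by have := ltn_ord j; lia.
  have jE : j = (j.-1).+1 :> nat by lia.
  move: mij; rewrite jE monoS ?ltn_predK //; last lia.
  case/andP=> mij oj; apply: (connect_trans (IH (Ordinal kn) _ mij)); first by move=> /=; lia.
  by apply/connect1/eo; rewrite /path_arrow /= -jE eqxx oj.
have kn : j.+1 < n by have := ltn_ord i; lia.
move: mij => /(monoNP o (ltnW ji)) mij.
apply: (connect_trans (IH (Ordinal kn) _ _)); first by move=> /=; lia.
  by apply/(monoNP o) => //= k kij; apply: mij; lia.
by apply/connect1/eo; rewrite /path_arrow /= eqxx mij ?orbT // leqnn.
Qed.

Lemma connect_path_arrow n (e : rel 'I_n) o :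
  (forall i j : 'I_n, e i j = path_arrow o i j) ->
  forall i j : 'I_n, connect e i j = mono o i j.
Proof.
move=> eo i j; apply/idP/idP => [cij|]; last first.
  by apply: mono_connect => x y; rewrite eo.
apply: (connect_invariant (P := fun j : 'I_n => mono o i j) _ cij).
  by move=> a b ma; rewrite eo; apply: mono_arrow.
exact: mono_refl.
Qed.

(* The oriented cycle, cut at the sink [0]: its arrow out of [n-1] ends at [0]. *)
Definition cyc_arrow n o (i j : nat) : bool :=
  path_arrow o i j || (i == n.-1) && (j == 0).

(** Position [n] is a second copy of the sink, reached through the closing arrow. *)
Definition cyc_le n o (i j : nat) : bool := mono o i j || (j == 0) && mono o i n.

Section CycleArrow.
Variables (n : nat) (e : rel 'I_n) (o : nat -> bool).
Hypotheses (n2 : 2 < n) (o0 : o 0 = false) (on1 : o n.-1).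
Hypothesis eo : forall i j : 'I_n, e i j = cyc_arrow n o i j.

Lemma mono_from_sink j : mono o 0 j -> j = 0.
Proof. by case: j => // j /(monoP o (leq0n _))/(_ 0 isT); rewrite o0. Qed.

Lemma mono_to_end i : i < n -> mono o i n = mono o i n.-1.
Proof.
by case: n n2 on1 => // m _ om im; rewrite monoS ?om ?andbT //.
Qed.

Lemma connect_cyc_arrow (i j : 'I_n) : connect e i j = cyc_le n o i j.
Proof.
have sub (x y : 'I_n) : path_arrow o x y -> e x y by rewrite eo /cyc_arrow => ->.
apply/idP/idP => [cij|].
  apply: (connect_invariant (P := fun j : 'I_n => cyc_le n o i j) _ cij); last first.
    by rewrite /cyc_le mono_refl.
  move=> a b; rewrite eo /cyc_le /cyc_arrow => leia ab.
  have a0 : a != 0 :> nat.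
    by apply/eqP => a0; move: ab; rewrite a0 /path_arrow o0 andbF /=; lia.
  move: leia; rewrite (negPf a0) orbF => ia.
  case/orP: ab => [ab|/andP[/eqP an /eqP ->]]; first by rewrite (mono_arrow ia ab).
  by rewrite mono_to_end // -an ia orbT.
rewrite /cyc_le => /orP[|/andP[/eqP j0 min]]; first exact: mono_connect.
have n1 : n.-1 < n by lia.
apply: (@connect_trans _ _ (Ordinal n1)).
  by apply: (mono_connect sub); rewrite /= -mono_to_end.
by apply: connect1; rewrite eo /cyc_arrow /= j0 !eqxx orbT.
Qed.

Hypothesis two : forall a, a < n -> ~~ (mono o a 0 && mono o a n).

(** Away from the sink this is [mono_cover]. For an arrow from [i] into the sink, a further vertex
    in between would make [i] reach the sink the other way round as well, against [two]. *)
Lemma cyc_cover (i j k : 'I_n) : e i j -> connect e i k -> connect e k j ->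
  (k == i) || (k == j).
Proof.
rewrite !connect_cyc_arrow eo -!val_eqE /= /cyc_le /cyc_arrow => aij ik kj.
have im := ltn_ord i; have jm := ltn_ord j; have km := ltn_ord k.
move: (i : nat) (j : nat) (k : nat) im jm km aij ik kj => {}i {}j {}k im jm km aij ik kj.
have [j0|j0] := eqVneq j 0; last first.
  rewrite (negPf j0) andbF orbF in aij.
  have {}kj : mono o k j by case/orP: kj => // /andP[]; rewrite (negPf j0).
  have k0 : k != 0.
    by apply/eqP => k0; move: kj; rewrite k0 => /mono_from_sink; apply/eqP.
  rewrite (negPf k0) /= orbF in ik.
  by case: (mono_cover aij ik kj) => ->; rewrite eqxx ?orbT.
have [->|k0] := eqVneq k 0; first by rewrite j0 eqxx orbT.
subst j; rewrite (negPf k0) orbF; rewrite eqxx /= in kj.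
have {}ik : mono o i k by case/orP: ik => // /andP[]; rewrite (negPf k0).
have i12 : i = 1 \/ i = n.-1.
  by case/orP: aij => [/orP[/andP[/eqP//]|/andP[/eqP -> _]]|/andP[/eqP -> _]]; auto.
have [//|ki] := eqVneq k i; exfalso.
case: i12 => i1; subst i.
  have k1 : 1 <= k by lia.
  move: ik => /(monoP o k1) ik; case/orP: kj => [/(monoNP o (leq0n _)) kj|/(monoP o (ltnW km)) kj].
    by have := kj 1; rewrite ik ?leqnn //=; lia.
  have /negP[] := two im; apply/andP; split.
    by apply/monoNP => // t t1; have -> : t = 0 by [lia]; rewrite o0.
  apply/monoP => [|t t1]; first lia.
  by have [kt|tk] := leqP k t; [apply: kj; lia|apply: ik; lia].
have kn : k <= n.-1 by lia.
move: ik => /(monoNP o kn) ik; case/orP: kj => [/(monoNP o (leq0n _)) kj|/(monoP o (ltnW km)) kj].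
  have /negP[] := two im; apply/andP; split; last by rewrite mono_to_end ?mono_refl.
  apply/monoNP => // t t1.
  by have [kt|tk] := leqP k t; [apply: ik; lia|apply: kj; lia].
by have := ik k; rewrite kj ?leqnn //=; lia.
Qed.
End CycleArrow.

Lemma path_normal_form n (Q : rel 'I_n) : acyclic_dg Q -> is_path_graph Q ->
  exists (s : {perm 'I_n}) (o : nat -> bool),
    forall i j, Q i j = path_arrow o (s i) (s j).
Proof.
move=> acy [s sE]; exists s.
pose o k := [exists i, exists j, [&& s i == k :> nat, s j == k.+1 :> nat & Q i j]].
have oE i j : (s i).+1 = s j -> o (s i) = Q i j.
  move=> ij; apply/existsP/idP => [[x /existsP[y /and3P[/eqP xi /eqP yj]]]|qij].
    have -> : x = i by apply/(@perm_inj _ s)/val_inj.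
    by have -> : y = j by apply/(@perm_inj _ s)/val_inj; rewrite /= yj ij.
  by exists i; apply/existsP; exists j; rewrite ij !eqxx qij.
exists o => i j; rewrite /path_arrow.
have := sE i j; rewrite /ugraph; have [ij|nij] := eqVneq (s i).+1 (s j).
  rewrite (oE _ _ ij) -ij /=.
  have -> : (s i == (s i).+2 :> nat) = false by lia.
  by rewrite orbF.
rewrite /=; have [ji|nji] := eqVneq (s j).+1 (s i).
  rewrite (oE _ _ ji) /=.
  have [qij|] := boolP (Q i j); first by rewrite (acyclic_antisym acy qij).
  by move=> _ /= ->.
by move=> /negbT; rewrite negb_or => /andP[/negPf].
Qed.

Lemma cycle_normal_form n (Q : rel 'I_n) x : acyclic_dg Q -> is_cycle_graph Q ->
  x \in sinks Q -> exists (s : {perm 'I_n}) (o : nat -> bool),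
    [/\ o 0 = false, o n.-1, o n = false &
      forall i j, Q i j = cyc_arrow n o (s i) (s j)].
Proof.
move=> acy [n2 [s0 sE0]] xsink.
have n0 : 0 < n by lia.
pose t := n - s0 x.
have s_inj : injective (fun i => Ordinal (ltn_pmod (s0 i + t) n0)).
  move=> i j /(congr1 val) /= /eqP; rewrite eqn_modDr !modn_small // => /eqP ij.
  exact/(@perm_inj _ s0)/val_inj.
pose s := perm s_inj; exists s.
have sE i j : ugraph Q i j = cyc_adj n (s i) (s j).
  by rewrite sE0 !permE /= cyc_adj_rot.
have sx : s x = 0 :> nat.
  by rewrite permE /= /t subnKC ?modnn // ltnW.
have Qx j : Q x j = false.
  by move: xsink; rewrite inE => /forallP/(_ j)/negPf.
have irr i : Q i i = false by apply: acyclic_irr.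
(* Bit [n.-1] is the closing arrow, which points into the sink. Bit [n] comes out false, like bit 0,
   as position [n] repeats the sink. *)
pose o k := (k == n.-1) ||
  [exists i, exists j, [&& s i == k :> nat, s j == k.+1 :> nat & Q i j]].
have oE i j : (s i).+1 = s j -> o (s i) = Q i j.
  move=> ij; have jn := ltn_ord (s j); rewrite /o; have -> : (s i == n.-1 :> nat) = false by lia.
  apply/existsP/idP => [[y /existsP[z /and3P[/eqP yi /eqP zj]]]|qij].
    have -> : y = i by apply/(@perm_inj _ s)/val_inj.
    by have -> : z = j by apply/(@perm_inj _ s)/val_inj; rewrite /= zj ij.
  by exists i; apply/existsP; exists j; rewrite ij !eqxx qij.
have x0 i : s i = 0 :> nat -> i = x.
  by move=> i0; apply/(@perm_inj _ s)/val_inj; rewrite /= sx.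
exists o; split.
- apply/negbTE/negP; rewrite /o; have -> : (0 == n.-1) = false by lia.
  by move=> /existsP[i /existsP[j /and3P[/eqP /x0 -> _]]]; rewrite Qx.
- by rewrite /o eqxx.
- apply/negbTE/negP; rewrite /o; have -> : (n == n.-1) = false by lia.
  move=> /existsP[i /existsP[j /and3P[/eqP e _ _]]].
  by have := ltn_ord (s i); rewrite e ltnn.
move=> i j; rewrite /cyc_arrow /path_arrow.
wlog ij : i j / s i < s j => [H|].
  have [|ji|/val_inj/perm_inj <-] := ltngtP (s i) (s j); first exact: H.
    have := H j i ji; have := sE i j; rewrite /ugraph cyc_adjC cyc_adjE ?ji //=.
    have -> : (s i == (s j).+1 :> nat) && o (s j) = (s i == (s j).+1 :> nat) && Q j i.
      by case: eqVneq => // e; rewrite (oE _ _ (esym e)).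
    have -> : (s i == (s j).+1 :> nat) && ~~ o (s j) = (s i == (s j).+1 :> nat) && ~~ Q j i.
      by case: eqVneq => // e; rewrite (oE _ _ (esym e)).
    have -> : (s j == (s i).+1 :> nat) = false by lia.
    have -> : (s j == n.-1 :> nat) = false by have := ltn_ord (s i); lia.
    rewrite /= !orbF.
    have [qij|nqij] := boolP (Q i j).
      by rewrite (acyclic_antisym acy qij) /= andbT => e1 _; rewrite [RHS]orbC andbC orbC.
    case: (Q j i) => /= e1 e2; last by rewrite andbT [X in _ || X]andbC.
    move: e2; rewrite andbT andbF => /esym/eqP e; apply/esym/negP => /andP[/eqP a /eqP b].
    by move: n2; rewrite -(prednK n0) -a e b.
  by rewrite irr; have := ltn_ord (s i); lia.
have := sE i j; rewrite /ugraph cyc_adjE ?ij //=.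
have -> : (s j == (s i).+1 :> nat) && o (s i) = (s j == (s i).+1 :> nat) && Q i j.
  by case: eqVneq => // e; rewrite (oE _ _ (esym e)).
have -> : (s i == (s j).+1 :> nat) = false by lia.
have -> : (s i == n.-1 :> nat) = false by have := ltn_ord (s j); lia.
rewrite /= !orbF; have [qij|] := boolP (Q i j); last by rewrite andbF.
rewrite andbT /= => /esym/orP[-> //|/andP[/eqP i0 _]].
by move: qij; rewrite (x0 _ i0) Qx.
Qed.

(** * Null vectors and sinks *)

Local Open Scope ring_scope.

Lemma path_cmpC o i j : path_cmp o i j = path_cmp o j i.
Proof. by rewrite /path_cmp addrC. Qed.

Lemma mono_left o i j : (i < j)%N -> mono o i j = o i && mono o i.+1 j.
Proof.
move=> ij; apply/(monoP o (ltnW ij))/andP => [H|[oi /(monoP o ij) H] k kij].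
  by split; [apply: H; lia|apply/monoP => // k kij; apply: H; lia].
by have [->//|ki] := eqVneq k i; apply: H; lia.
Qed.

Lemma monoN_left o i j : (i < j)%N -> mono o j i = ~~ o i && mono o j i.+1.
Proof.
move=> ij; apply/(monoNP o (ltnW ij))/andP => [H|[oi /(monoNP o ij) H] k kij].
  by split; [apply: H; lia|apply/monoNP => // k kij; apply: H; lia].
by have [->//|ki] := eqVneq k i; apply: H; lia.
Qed.

Lemma path_cmp1 o i : path_cmp o i i.+1 = 1.
Proof. by rewrite /path_cmp monoS // monoSN // mono_refl; case: (o i). Qed.

Lemma path_cmp_left o i j : (i.+1 < j)%N ->
  path_cmp o i j = (o i == o i.+1)%:R * path_cmp o i.+1 j.
Proof.
move=> ij; rewrite /path_cmp !(mono_left o (ltnW ij)) !(monoN_left o (ltnW ij)).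
rewrite !(mono_left o ij) !(monoN_left o ij).
by case: (o i); case: (o i.+1); rewrite /= ?mul0r ?mul1r ?addr0 ?add0r.
Qed.

Lemma path_cmp_right o i j : (j <= i)%N ->
  path_cmp o i.+2 j = (o i == o i.+1)%:R * path_cmp o i.+1 j.
Proof.
move=> ji; rewrite /path_cmp !monoS ?monoSN // ?(leqW ji) //.
by case: (o i); case: (o i.+1); rewrite /= ?andbF ?andbT ?mul0r ?mul1r ?addr0 ?add0r.
Qed.

(** The direction of the edge entering [j]; at 0 it is the closing arrow, hence 1. *)
Definition edge_bit (o : nat -> bool) j : int := if j is j'.+1 then (o j')%:R else 1.

(* [null_vec] is [1] at sinks, [-1] at sources and [0] at the other vertices. *)
Definition null_vec (o : nat -> bool) j : int := edge_bit o j - (o j)%:R.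

Section NullVector.
Variables (n : nat) (o : nat -> bool).
Hypotheses (n2 : (2 < n)%N) (o0 : o 0%N = false) (on1 : o n.-1) (on : o n = false).

(** To the right of [i] only the run leaving it is comparable to [i], and there [null_vec] is
    nonzero only at the final turn: 1 if the run goes up to a sink, -1 if it comes down from a
    source. *)
Lemma null_sum_right i : (i < n)%N ->
  \sum_(i.+1 <= j < n.+1) path_cmp o i j * null_vec o j = (o i)%:R *+ 2 - 1.
Proof.
move=> im; have [d] := ubnP (n - i); elim: d i im => // d IH i im; rewrite ltnS => di.
rewrite big_ltn // path_cmp1 mul1r.
have [i1|i1] : i.+1 = n \/ (i.+1 < n)%N by lia.
  have oi : o i by move: on1; rewrite -i1.
  by rewrite big_geq ?i1 // -i1 /null_vec /edge_bit i1 on oi.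
under eq_big_nat => j /andP[ij _] do rewrite path_cmp_left // -mulrA.
rewrite -mulr_sumr IH //; last by lia.
by rewrite /null_vec /edge_bit; case: (o i); case: (o i.+1).
Qed.

Lemma null_sum_left i :
  \sum_(0 <= j < i.+1) path_cmp o i.+1 j * null_vec o j = 1 - (o i)%:R *+ 2.
Proof.
elim: i => [|i IH].
  by rewrite big_nat1 path_cmpC path_cmp1 /null_vec /edge_bit o0.
rewrite big_nat_recr //= path_cmpC path_cmp1 mul1r.
under eq_big_nat => j /andP[_ ij] do rewrite path_cmp_right // -mulrA.
rewrite -mulr_sumr IH.
by rewrite /null_vec /edge_bit; case: (o i); case: (o i.+1).
Qed.

Lemma null_vec0 : null_vec o 0 = 1.
Proof. by rewrite /null_vec o0. Qed.

Lemma null_vecn : null_vec o n = 1.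
Proof. by rewrite /null_vec /edge_bit on; case: n on1 n2 => // m ->. Qed.

Hypothesis two : forall a, (a < n)%N -> ~~ (mono o a 0 && mono o a n).

(** The comparabilities of the sink are those of its copies 0 and [n] on the unfolded path; by [two]
    none is counted twice. *)
Lemma cyc_cmp i j : (i < n)%N -> (j < n)%N ->
  (cyc_le n o i j)%:R + (cyc_le n o j i)%:R = path_cmp o i j +
    ((j == 0%N) && (i != 0%N))%:R * path_cmp o i n +
    ((i == 0%N) && (j != 0%N))%:R * path_cmp o j n :> int.
Proof.
have mono0 k : k != 0%N -> mono o 0 k = false.
  by move=> k0; apply: contraNF k0 => /(mono_from_sink o0) ->.
have monon k : (k < n)%N -> mono o n k = false.
  by move=> km; apply/negP => /(monoNP o (ltnW km))/(_ n.-1); rewrite on1; lia.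
move=> im jm; rewrite /cyc_le /path_cmp.
have nz : n != 0%N by lia.
have [->|i0] := eqVneq i 0%N; have [->|j0] := eqVneq j 0%N.
- by rewrite mono_refl /= !mul0r !addr0.
- have := two jm; rewrite (mono0 j) // (mono0 n) // (monon j) // /= !mul0r mul1r !addr0 !add0r.
  by case: (mono o j 0); case: (mono o j n).
- have := two im; rewrite (mono0 i) // (monon i) // /= !mul0r mul1r !addr0.
  by case: (mono o i 0); case: (mono o i n).
by rewrite /= !mul0r !addr0 !orbF.
Qed.

(** On the unfolded path the sums left and right of [j] cancel the diagonal term 2 [null_vec o j].
    For the sink, the sum right of 0 and the sum left of [n] are each -1 and cancel the diagonal
    2. *)
Lemma null_vec_cyc j : (j < n)%N ->
  \sum_(i < n) null_vec o i * ((cyc_le n o i j)%:R + (cyc_le n o j i)%:R) = 0.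
Proof.
move=> jm.
rewrite -(big_mkord xpredT (fun i => null_vec o i * ((cyc_le n o i j)%:R + (cyc_le n o j i)%:R))).
under eq_big_nat => i /andP[_ im] do rewrite cyc_cmp //.
have n0 : (0 < n)%N by lia.
have cmp0n : path_cmp o 0 n = 0.
  have := two n0; rewrite mono_refl /= /path_cmp => /negPf ->.
  by rewrite (_ : mono o n 0 = false) //; apply/negP => /(monoNP o (leq0n _))/(_ n.-1); rewrite on1; lia.
have [->|j0] := eqVneq j 0%N.
  rewrite big_ltn // null_vec0 mul1r /= !mul0r !addr0 {1}/path_cmp mono_refl.
  have R0 := null_sum_right n0; rewrite big_nat_recr //= cmp0n mul0r addr0 in R0.
  have Ln := null_sum_left n.-1.
  rewrite (prednK n0) on1 big_ltn // (path_cmpC o n 0) cmp0n mul0r add0r in Ln.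
  rewrite (_ : \sum_(1 <= i < n) _ = \sum_(1 <= i < n) path_cmp o n i * null_vec o i +
    \sum_(1 <= i < n) path_cmp o 0 i * null_vec o i).
    by rewrite Ln R0 o0.
  rewrite -big_split; apply: eq_big_nat => i /andP[i1 im] /=.
  have -> : (i == 0%N) = false by lia.
  rewrite /= mul0r addr0 mul1r [path_cmp o i 0]path_cmpC [path_cmp o n i]path_cmpC; ring.
have -> : \sum_(0 <= i < n) null_vec o i * (path_cmp o i j + (false && (i != 0%N))%:R * path_cmp o i n
     + ((i == 0%N) && true)%:R * path_cmp o j n) =
   \sum_(0 <= i < n.+1) path_cmp o j i * null_vec o i.
  rewrite [RHS]big_nat_recr //= null_vecn mulr1 big_ltn // [in RHS]big_ltn //.
  rewrite /= !mul0r !addr0 !mul1r null_vec0 mul1r mulr1 [path_cmp o 0 j]path_cmpC addrAC.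
  congr (_ + _ + _); apply: eq_big_nat => i /andP[i1 _].
  have -> : (i == 0%N) = false by lia.
  by rewrite /= !mul0r !addr0 path_cmpC mulrC.
rewrite (@big_cat_nat _ _ _ j) //=; last by lia.
rewrite (@big_ltn _ _ _ j) ?null_sum_right //; last by lia.
case: j j0 jm => // j _ jm; rewrite null_sum_left.
by rewrite /path_cmp mono_refl /null_vec /edge_bit; case: (o j); case: (o j.+1).
Qed.
End NullVector.

Lemma path_type n (Q : rel 'I_n) (s : {perm 'I_n}) o :
  (forall i j, Q i j = path_arrow o (s i) (s j)) ->
  positive_poset Q /\ Dyn_is Q (DynA n).
Proof.
move=> Qs; apply: (@positive_type _ _ (s^-1)%g).
have [B [uB BD]] := congruent_path o n.
split=> //; [exact: perm_inj|exact: pos_def_dynA|exists B; split=> // i j].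
pose e : rel 'I_n := fun i j => path_arrow o i j.
rewrite -BD (@iso_cmp2 _ Q e s) // mxE.
by rewrite !(@connect_path_arrow _ e o).
Qed.

(** No directed path passes through a sink, so deleting it preserves the other comparabilities; the
    remaining path has the orientation shifted by one. *)
Lemma cycle_type n (Q : rel 'I_n) (s : {perm 'I_n}) o :
  (2 < n)%N -> o 0%N = false -> o n.-1 -> o n = false ->
  (forall i j, Q i j = cyc_arrow n o (s i) (s j)) ->
  (forall a, (a < n)%N -> ~~ (mono o a 0 && mono o a n)) ->
  principal_poset Q /\ Dyn_is Q (DynA n.-1).
Proof.
case: n Q s => // m Q s m2 o0 om on Qs two; rewrite -pred_Sn.
pose e : rel 'I_m.+1 := fun i j => cyc_arrow m.+1 o i j.
have ce (i j : 'I_m.+1) : connect e i j = cyc_le m.+1 o i j by apply: connect_cyc_arrow.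
have [B [uB BD]] := congruent_path (fun k => o k.+1) m.
apply: (@principal_type _ _ _ (fun i => (s^-1)%g (lift ord0 i)) ((s^-1)%g ord0)
  (\row_i null_vec o (s i))) => //.
- split=> //; [by move=> i j /perm_inj/lift_inj|exact: pos_def_dynA|exists B; split=> // i j].
  rewrite -BD (@iso_cmp2 _ Q e s) // mxE !ce /cyc_le /= !orbF.
  by rewrite /path_cmp !mono_shift.
- by move=> i; rewrite (inj_eq (@perm_inj _ _)).
- by rewrite mxE permKV null_vec0.
apply/rowP => j; rewrite mxE [RHS]mxE (reindex_inj (@perm_inj _ (s^-1)%g)) /=.
rewrite -[RHS](null_vec_cyc m2 o0 om on two (ltn_ord (s j))).
apply: eq_bigr => i _; rewrite mxE permKV; congr (_ * _).
by rewrite (@iso_cmp2_perm _ Q e s) // permKV mxE !ce.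
Qed.

Local Close Scope ring_scope.

(** * Sinks of an oriented cycle *)

Section Sinks.
Variables (n : nat) (Q : rel 'I_n) (s : {perm 'I_n}) (o : nat -> bool).
Hypotheses (n2 : 2 < n) (o0 : o 0 = false) (on1 : o n.-1).
Hypothesis Qs : forall i j, Q i j = cyc_arrow n o (s i) (s j).

Lemma mem_sinks i : (i \in sinks Q) = (s i == 0 :> nat) || o (s i).-1 && ~~ o (s i).
Proof.
have im := ltn_ord (s i); rewrite inE; apply/forallP/idP => [H|].
  have [//|i0] := eqVneq (s i : nat) 0.
  have out k (km : k < n) : cyc_arrow n o (s i) k = false.
    by have := H ((s^-1)%g (Ordinal km)); rewrite Qs permKV => /negPf.
  have k1 : (s i).-1 < n by lia.
  have := out _ k1; rewrite /cyc_arrow /path_arrow prednK ?lt0n // eqxx /= => /negbT.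
  rewrite !negb_or negbK => /andP[/andP[_ ->] _] /=.
  have [in1|in1] : s i = n.-1 :> nat \/ (s i).+1 < n by lia.
    have n0 : 0 < n by lia.
    by have := out _ n0; rewrite /cyc_arrow in1 !eqxx orbT.
  by have := out _ in1; rewrite /cyc_arrow /path_arrow eqxx /= => /negbT; rewrite !negb_or => /andP[/andP[]].
move=> H j; rewrite Qs /cyc_arrow /path_arrow; apply/negP.
case/orP: H => [/eqP i0|/andP[o1 o2]].
  rewrite i0 o0 andbF /= => /andP[/eqP]; lia.
case/orP => [/orP[]|] /andP[/eqP e].
- by rewrite (negPf o2).
- by move: o1; rewrite e => /= ->.
by move: o2; rewrite e on1.
Qed.

(** If [a] reached the sink from both sides, all edges before [a] would point down and all later
    ones up, leaving 0 as the only sink. *)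
Lemma two_sinks : 1 < #|sinks Q| -> forall a, a < n -> ~~ (mono o a 0 && mono o a n).
Proof.
move=> S2 a an; apply/negP => /andP[/(monoNP o (leq0n _)) oa /(monoP o (ltnW an)) oa'].
have S0 i : i \in sinks Q -> s i = 0 :> nat.
  rewrite mem_sinks => /orP[/eqP //|/andP[o1 o2]].
  have im := ltn_ord (s i).
  have [ia|ai] := ltnP (s i).-1 a; first by have := oa (s i).-1; rewrite o1; lia.
  by have := oa' (s i); rewrite (negPf o2); lia.
move: S2; rewrite ltnNge => /negP; apply; apply/card_le1_eqP => i j /S0 i0 /S0 j0.
by apply/(@perm_inj _ s)/val_inj; rewrite /= i0 j0.
Qed.

(** A switch of [o] from true to false would be a second sink, so [o] is a threshold, at the unique
    source [a]. *)
Lemma one_sink : #|sinks Q| = 1 ->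
  exists a, 0 < a < n /\ forall k, k < n -> o k = (a <= k).
Proof.
move=> /eqP/cards1P[x Sx].
have only k (km : k < n) : 0 < k -> ~~ (o k.-1 && ~~ o k).
  move=> k0; apply/negP => ok; have n0 : 0 < n by lia.
  have : (s^-1)%g (Ordinal km) \in sinks Q by rewrite mem_sinks permKV ok orbT.
  have : (s^-1)%g (Ordinal n0) \in sinks Q by rewrite mem_sinks permKV eqxx.
  rewrite Sx !inE => /eqP <- /eqP/perm_inj/(congr1 val) /= k0'.
  by rewrite k0' in k0.
case: (ex_minnP (ex_intro (fun k => o k) _ on1)) => a oa amin.
exists a; split.
  have := amin _ on1; have a0 : a <> 0 by move=> a0; rewrite a0 o0 in oa.
  lia.
move=> k kn; have [ak|ka] := leqP a k; last by apply: contraTF ka => /amin; lia.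
elim: k kn ak => [|k IH] kn ak; first by have -> : 0 = a by lia.
have [<-//|ak'] := eqVneq a k.+1.
have := only _ kn isT; rewrite /= IH ?negbK //; lia.
Qed.

Lemma one_sink_abar : #|sinks Q| = 1 -> exists p r, iso_abar Q p r.
Proof.
move=> /one_sink[a [an oa]].
pose b := n - a <= a.
exists (if b then a else n - a), (if b then n - a else a).
have bE : b = (n - a <= a) by [].
(* From the source [a] one chain descends to 0 in [a] arrows, the other climbs to [n] in [n - a]
   arrows; [b] says which is numbered first, so that r <= p. The source gets label 0 and the sink
   label [n.-1]. *)
pose t i := if i == 0 then n.-1 else
  if b then (if i <= a then a - i else i.-1)
  else (if a <= i then i - a else n.-1 - i).
have tn (i : 'I_n) : t i < n by rewrite /t; have := ltn_ord i; do !case: ifP => ?; lia.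
have t_inj : injective (fun i => Ordinal (tn (s i))).
  move=> i j /(congr1 val) /= tij; apply/(@perm_inj _ s)/val_inj => /=.
  move: tij; have := ltn_ord (s i); have := ltn_ord (s j); rewrite /t bE.
  by do !case: ifP => ?; lia.
split; [by rewrite bE; case: ifP; lia|by rewrite bE; case: ifP; lia|by rewrite bE; case: ifP; lia|].
exists (perm t_inj) => i j; rewrite abarE; [|by rewrite bE; case: ifP; lia..].
rewrite !permE /= Qs /cyc_arrow /path_arrow !oa //.
have im := ltn_ord (s i); have jm := ltn_ord (s j).
move: (s i : nat) (s j : nat) im jm => x y {i j} xn yn.
(* The boolean [b], read as 0 or 1, moves the cut so that the source falls on the side of the first
   chain. *)
have tE z : z < n -> [\/ z = 0 /\ t z = n.-1,
    0 < z < a + b /\ t z = (if b then a - z else n.-1 - z) |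
    a + b <= z /\ t z = if b then z.-1 else z - a].
  rewrite /t => zn; case: eqVneq => [z0|z0]; first by constructor 1.
  by have [za|za] := ltnP z (a + b); [constructor 2|constructor 3];
    move: za; rewrite ?bE; split=> //; do ?case: ifP; lia.
move: (t x) (t y) (tE x xn) (tE y yn) => u v; rewrite /abar_arrow bE.
clear t tn t_inj tE b bE; have [H|H] := leqP (n - a) a => -[] [x1 ux] [] [y1 vy];
  apply/idP/idP => [/orP[/orP[]|] /andP[/eqP e e']|
    /or4P[/andP[/eqP e e']|/andP[/eqP e /eqP e']|/andP[/eqP e /eqP e']|/and3P[e /eqP e' e2]]]; lia.
Qed.
End Sinks.

Lemma path_hasse n (Q : rel 'I_n) (s : {perm 'I_n}) o : acyclic_dg Q ->
  (forall i j, Q i j = path_arrow o (s i) (s j)) -> hasse Q =2 Q.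
Proof.
move=> acy Qs; apply: hasseE => // i j k.
pose e : rel 'I_n := fun i j => path_arrow o i j.
rewrite !(@iso_connect _ Q e s) // !(@connect_path_arrow _ e o) // Qs => ij ik kj.
by case: (mono_cover ij ik kj) => /val_inj/perm_inj ->; rewrite eqxx ?orbT.
Qed.

Lemma cycle_hasse n (Q : rel 'I_n) (s : {perm 'I_n}) o : acyclic_dg Q ->
  2 < n -> o 0 = false -> o n.-1 ->
  (forall i j, Q i j = cyc_arrow n o (s i) (s j)) ->
  (forall a, a < n -> ~~ (mono o a 0 && mono o a n)) -> hasse Q =2 Q.
Proof.
move=> acy n2 o0 on1 Qs two; apply: hasseE => // i j k.
pose e : rel 'I_n := fun i j => cyc_arrow n o i j.
rewrite !(@iso_connect _ Q e s) // -[k == i](inj_eq (@perm_inj _ s)).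
rewrite -[k == j](inj_eq (@perm_inj _ s)) Qs.
exact: (@cyc_cover _ e o).
Qed.

Theorem theorem4p2 (n : nat) (Q : rel 'I_n) :
  0 < n -> connected_dg Q -> acyclic_dg Q -> (forall i, degree Q i <= 2) ->
  let caseA :=
    [/\ ~ two_regular Q, is_path_graph Q, hasse Q =2 Q,
        positive_poset Q & Dyn_is Q (DynA n)] in
  let caseB :=
    [/\ two_regular Q, is_cycle_graph Q,
        (#|sinks Q| = 1 ->
          [/\ iso_abar Q (n - 1) 1 ->
                [/\ Dyn_is Q (DynA n), positive_poset Q & ~ (hasse Q =2 Q)],
              iso_abar Q (n - 2) 2 ->
                [/\ Dyn_is Q (DynD n), positive_poset Q & hasse Q =2 Q],
              [/\ iso_abar Q 3 3 ->
                    [/\ hasse Q =2 Q, positive_poset Q & Dyn_is Q DynE6],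
                  iso_abar Q 4 3 ->
                    [/\ hasse Q =2 Q, positive_poset Q & Dyn_is Q DynE7],
                  iso_abar Q 5 3 ->
                    [/\ hasse Q =2 Q, positive_poset Q & Dyn_is Q DynE8],
                  iso_abar Q 4 4 ->
                    [/\ hasse Q =2 Q, principal_poset Q & Dyn_is Q DynE7] &
                  iso_abar Q 6 3 ->
                    [/\ hasse Q =2 Q, principal_poset Q & Dyn_is Q DynE8]] &
              (~ iso_abar Q (n - 1) 1 -> ~ iso_abar Q (n - 2) 2 ->
               ~ iso_abar Q 3 3 -> ~ iso_abar Q 4 3 -> ~ iso_abar Q 5 3 ->
               ~ iso_abar Q 4 4 -> ~ iso_abar Q 6 3 ->
               indefinite_poset Q)]) &
        (1 < #|sinks Q| ->
          [/\ principal_poset Q, Dyn_is Q (DynA n.-1) & hasse Q =2 Q])] in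
  (caseA /\ ~ caseB) \/ (caseB /\ ~ caseA).
Proof.
move=> n0 conn acy deg; have [pathQ|cycQ] := path_or_cycle n0 conn acy deg.
  have nreg := path_not_regular n0 pathQ.
  left; split; last by case.
  have [s [o Qs]] := path_normal_form acy pathQ.
  by have [posQ DynQ] := path_type Qs; split=> //; apply: path_hasse Qs.
have reg := cycle_regular cycQ; right; split; last by case=> /(_ reg).
have n2 : 2 < n by case: cycQ.
split=> // [S1|S2].
- split.
  + move=> QA; have [n1 sz] : 1 < n /\ dyn_size (DynA n) = n by split=> //; lia.
    have [] := iso_abar_positive QA sz (@pos_def_dynA n) (congruent_abar1 n1).
    by split=> //; apply: iso_abar1_hasse.
  (* [iso_abar] contains r <= p, which rules out n = 3. *)
  + move=> QA; have n3 : 3 < n by case: QA; lia.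
    have [] := iso_abar_positive (D := DynD n) QA erefl (pos_def_dynD n3) (congruent_D n3).
    by split=> //; apply: iso_abar_hasse QA.
  + split=> QA; have hQ : hasse Q =2 Q by apply: (iso_abar_hasse acy _ QA).
    * have [_ _ e _] := QA; subst n.
      by have [] := iso_abar_positive (D := DynE6) QA erefl pos_def_E6 congruent_E6.
    * have [_ _ e _] := QA; subst n.
      by have [] := iso_abar_positive (D := DynE7) QA erefl pos_def_E7 congruent_E7.
    * have [_ _ e _] := QA; subst n.
      by have [] := iso_abar_positive (D := DynE8) QA erefl pos_def_E8 congruent_E8.
    * by have [] := iso_abar44 QA.
    * by have [] := iso_abar63 QA.
  have [x xS] : exists x, x \in sinks Q by apply/card_gt0P; rewrite S1.
  have [s [o [o0 on1 _ Qs]]] := cycle_normal_form acy cycQ xS.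
  have [p [r QA]] := one_sink_abar n2 o0 on1 Qs S1.
  have [r0 rp prn _] := QA; move=> N1 N2 N33 N43 N53 N44 N63.
  have r1 : r <> 1 by move=> e; apply: N1; have -> : n - 1 = p by [lia]; rewrite -e.
  have r2 : r <> 2 by move=> e; apply: N2; have -> : n - 2 = p by [lia]; rewrite -e.
  have excl a b : ~ iso_abar Q a b -> ~ (p = a /\ r = b).
    by move=> N [pa rb]; apply: N; rewrite -pa -rb.
  move: {N33 N43 N53 N44 N63} (excl _ _ N33) (excl _ _ N43) (excl _ _ N53)
    (excl _ _ N44) (excl _ _ N63) => N33 N43 N53 N44 N63.
  apply: (iso_abar_indefinite QA); first lia.
  (* The goal is (p-2)(r-2) > 4: for r = 3 it needs p > 6, for r = 4 it needs p > 4, and for larger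
     r it follows from r <= p. *)
  have [r3|[r4|r5]] : r = 3 \/ r = 4 \/ 4 < r by lia.
  + by subst r; lia.
  + by subst r; lia.
  nia.
have [x xS] : exists x, x \in sinks Q by apply/card_gt0P; apply: ltnW.
have [s [o [o0 on1 on Qs]]] := cycle_normal_form acy cycQ xS.
have two := two_sinks n2 o0 on1 Qs S2.
have [] := cycle_type n2 o0 on1 on Qs two.
by split=> //; apply: cycle_hasse Qs two.
Qed.
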